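(* For all integers $n\ge 4$, the minimal number of black stones that must be placed on an otherwise empty Hex board of size $4\times n$ to create a virtual connection between Black's edges is exactly $\lceil \tfrac{2}{3}n-2\rceil$.
   Context: Hex is played on a parallelogram-shaped board of hexagonal cells, with the usual hexagonal adjacency. A board of size $4\times n$ consists of $n$ columns of $4$ cells each; Black's two edges are the two short sides of the board (bordering the first and last columns, respectively), and White's two edges are the two long sides. Players alternately place a stone of their color on an empty cell; Black wins if at the end (board full) there is a chain of adjacent black stones connecting Black's two edges, otherwise White wins (exactly one player wins). A placement of black stones on the board (all other cells empty) is a virtual connection for Black if Black wins from that position even when White moves first, i.e., Black has a second-player winning strategy from it. *)

(* Defs.v *)
From mathcomp Require Import all_boot all_order all_algebra.
Set Implicit Arguments. Unset Strict Implicit. Unset Printing Implicit Defensive.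
Import Order.TTheory GRing.Theory Num.Theory.

(* A cell of the 4 x n Hex board: (row, column), row in 0..3, column in 0..n-1.
   Each of the n columns contains 4 cells.  Black's edges border column 0 and
   column n-1; White's edges border row 0 and row 3. *)
Definition cell (n : nat) := ('I_4 * 'I_n)%type.

Definition hex_adj (n : nat) (x y : cell n) : bool :=
  let r1 := (x.1 : nat) in let c1 := (x.2 : nat) in
  let r2 := (y.1 : nat) in let c2 := (y.2 : nat) in
  [|| (r1 == r2) && ((c1 == c2.+1) || (c2 == c1.+1)),
      (c1 == c2) && ((r1 == r2.+1) || (r2 == r1.+1)),
      (r1 == r2.+1) && (c2 == c1.+1)
    | (r2 == r1.+1) && (c1 == c2.+1)].

(* A position: each cell is empty (None), black (Some true) or white (Some false). *)
Definition position (n : nat) := cell n -> option bool.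

Definition full (n : nat) (P : position n) : Prop := forall x, P x <> None.

Definition black_connected (n : nat) (P : position n) : Prop :=
  exists x y : cell n,
    [/\ P x = Some true, (x.2 : nat) = 0%N, P y = Some true, (y.2 : nat) = n.-1 &
      connect (fun a b => (P a == Some true) && (P b == Some true) && hex_adj a b) x y].

Definition place (n : nat) (P : position n) (x : cell n) (b : bool) : position n :=
  fun y => if y == x then Some b else P y.

(* black_wins P b : Black wins (under optimal play, the game being played until
   the board is full) from position P, with Black to move iff b = true. *)
Inductive black_wins (n : nat) : position n -> bool -> Prop :=
  | bw_end P b : full P -> black_connected P -> black_wins P b
  | bw_black P : ~ full P ->
      (exists x, P x = None /\ black_wins (place P x true) false) ->
      black_wins P true
  | bw_white P : ~ full P ->
      (forall x, P x = None -> black_wins (place P x false) true) ->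
      black_wins P false.

Definition stones (n : nat) (S : {set cell n}) : position n :=
  fun x => if x \in S then Some true else None.

Definition virtual_connection (n : nat) (S : {set cell n}) : Prop :=
  black_wins (stones S) false.

(* Main.v *)
(* Upper bound.  Number the rows 0 to 3 and put stones at (1,3i+2) and (2,3i+3),
   in the columns 2 to n-2.  Consecutive stones are linked by bridges, and at
   either end a stone two columns away from the edge reaches it by a template
   of eight cells.  All of these are pairs of cells of which Black needs only
   one, so Black wins by a pairing strategy.

   Lower bound.  A pattern is a set of cells in a window of at most ten
   consecutive columns such that White, moving first, wins inside it even if all
   other cells are black.  Every virtual connection meets every pattern.  Read
   the board from left to right and let e = 3 * (stones) - 2 * (columns) for the
   part already read: for a suitable finite list of patterns, meeting all of
   them forces e >= -6.  Whenever e >= 0 the part already read may be replaced by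
   solid black, so only a finite set of states (the last nine columns, e) has to
   be inspected.  The patterns, White's moves in them, and the set of states were
   found by computer search; only their validity is checked here. *)
Require Import Defs.
From Stdlib Require Import NArith String Ascii FunctionalExtensionality.
From mathcomp Require Import all_boot all_order all_algebra.
From mathcomp Require Import zify lra.
Import Order.TTheory GRing.Theory Num.Theory.
Set Implicit Arguments. Unset Strict Implicit. Unset Printing Implicit Defensive.
Local Open Scope nat_scope.

(** * The game *)

Section Game.
Variable n : nat.
Implicit Types (P : position n) (x y : cell n).

Definition empties P : {set cell n} := [set x | P x == None].

Lemma place_same P x b : place P x b x = Some b.
Proof. by rewrite /place eqxx. Qed.

Lemma place_other P x b y : y != x -> place P x b y = P y.
Proof. by rewrite /place => /negbTE ->. Qed.

Lemma placeP P x b c y :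
  place P x b y = Some c -> (y = x /\ b = c) \/ P y = Some c.
Proof. by rewrite /place; case: eqP => [-> [->]|_ ->]; [left|right]. Qed.

Lemma card_empties_place P x b :
  P x = None -> #|empties (place P x b)| < #|empties P|.
Proof.
move=> Px; apply: proper_card; apply/properP; split.
  by apply/subsetP => y; rewrite !inE /place; case: (y == x).
by exists x; rewrite !inE ?Px // place_same.
Qed.

Lemma full_or_empty P : full P \/ exists x, P x = None.
Proof.
case: (set_0Vmem (empties P)) => [E|[x]]; last by rewrite inE => /eqP; right; exists x.
by left => x Px; move/setP/(_ x): E; rewrite !inE Px.
Qed.

Lemma black_wins_turn P b :
  black_wins P b ->
  (full P /\ black_connected P) \/
  ((exists z, P z = None) /\
   if b then exists x, P x = None /\ black_wins (place P x true) false
   else forall x, P x = None -> black_wins (place P x false) true).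
Proof.
by case=> {P b} [P b fP cP|P nf h|P nf h]; [left|case: (full_or_empty P); [|right]..].
Qed.

(* If White already owns the cell the strategy calls for, any other move will do. *)
Lemma white_move (I J : position n -> Prop) z :
  (forall P, I P -> P z <> Some true) ->
  (forall P, I P -> P z = Some false -> J P) ->
  (forall P x, I P -> P x = None -> I (place P x false)) ->
  (forall P, J P -> ~ black_wins P true) ->
  forall P, I P -> ~ black_wins P false.
Proof.
move=> Iz IJ Iext JN P IP /black_wins_turn[[fP cP]|[[y Py] h]].
  case Ez: (P z) => [[]|]; [exact: Iz Ez|apply: JN (IJ _ IP Ez) _; exact: bw_end|exact: fP Ez].
case Ez: (P z) => [[]|]; first exact: Iz Ez.
- have yz : z != y by apply: contra_eq_neq Ez => ->; rewrite Py.
  by apply: JN (IJ _ (Iext _ _ IP Py) _) (h y Py); rewrite place_other.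
- by apply: JN (IJ _ (Iext _ _ IP Ez) _) (h z Ez); rewrite place_same.
Qed.

(** White answers at the mate of Black's last cell if that mate is empty, and anywhere otherwise.
    After each answer every mate of a black cell is white, so no pair ever becomes entirely black
    and [cut] applies once the board is full. *)
Lemma pairing_blocks (W : pred (cell n)) (mate : rel (cell n)) :
  symmetric mate -> irreflexive mate ->
  (forall x y z, mate x y -> mate x z -> y = z) ->
  (forall P, (forall x, W x -> P x = Some false) ->
     (forall x y, mate x y -> ~ (P x = Some true /\ P y = Some true)) ->
     ~ black_connected P) ->
  forall P, (forall x, W x -> P x = Some false) ->
    (forall x y, mate x y -> P x = Some true -> P y = Some false) ->
    ~ black_wins P true.
Proof.
move=> mC mI mF cut P; have [m] := ubnP #|empties P|.
elim: m P => // m IH P /ltnSE-le PW PM /black_wins_turn.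
have noconn Q : (forall x, W x -> Q x = Some false) ->
    (forall x y, mate x y -> Q x = Some true -> Q y = Some false) -> ~ black_connected Q.
  by move=> QW QM; apply: cut QW _ => x y /QM h [/h ->].
case=> [[fP]|[_ [y [Py]]]]; first exact: noconn.
have P1W x : W x -> place P y true x = Some false.
  by move=> Wx; rewrite place_other ?PW //; apply: contra_eq_neq (PW x Wx) => ->; rewrite Py.
have lt1 := card_empties_place true Py.
set P1 := place P y true in P1W lt1 *.
(* A white stone at [z] restores the invariant as soon as all mates of [y] are white; the induction
   on the number of empty cells then takes over. *)
have go z : P1 z = None ->
    (forall x, mate y x -> place P1 z false x = Some false) ->
    ~ black_wins (place P1 z false) true.
  move=> P1z yz; apply: IH.
  - by apply: leq_trans (card_empties_place false P1z) _; apply: leq_trans (ltnW lt1) le.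
  - by move=> x Wx; rewrite /place; case: eqP => // _; apply: P1W.
  - move=> a b ab /placeP[[]|/placeP[[ay _]|Pa]] //.
      by apply: yz; rewrite -ay.
    have bF := PM _ _ ab Pa.
    rewrite /place; case: (b =P z) => // _; rewrite /P1 place_other //.
    by apply: contra_eq_neq bF => ->; rewrite Py.
case/black_wins_turn=> [[fP1]|[[z0 P1z0] h]].
  apply: noconn P1W _ => a b ab /placeP[[ay _]|Pa].
    subst a; have: P1 b <> None by exact: fP1.
    have yb : b != y by apply: contraTneq ab => ->; rewrite mI.
    rewrite /P1 place_other //; case Eb: (P b) => [[]|] // _.
    by rewrite mC in ab; move: (PM _ _ ab Eb); rewrite Py.
  have bF := PM _ _ ab Pa.
  by rewrite /P1 place_other //; apply: contra_eq_neq bF => ->; rewrite Py.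
case: (pickP (fun b => mate y b && (P1 b == None))) => [b /andP[yb /eqP P1b]|nob].
  apply: go (h b P1b) => // x yx; rewrite (mF _ _ _ yx yb); exact: place_same.
(* No mate of [y] is empty, so each is already white: by symmetry of [mate], a black one would have
   forced [y] to be white. *)
apply: go (h z0 P1z0) => // x yx.
have /negbT := nob x; rewrite yx /= => Px.
have xy : x != y by apply: contraTneq yx => ->; rewrite mI.
rewrite /place; case: (x =P z0) => // _.
move: Px; rewrite /P1 place_other //; case Ex: (P x) => [[]|] // _.
by rewrite mC in yx; move: (PM _ _ yx Ex); rewrite Py.
Qed.

End Game.

(** * A virtual connection with few stones *)

(** The same pairing strategy for Black as second player, with the invariant that every mate of a
    white cell is black. In a full position this means that each pair contains a black cell. *)
Lemma pairing_wins n (S : {set cell n}) (mate : rel (cell n)) :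
  symmetric mate -> irreflexive mate ->
  (forall x y z, mate x y -> mate x z -> y = z) ->
  (forall P : position n, full P -> (forall x, x \in S -> P x = Some true) ->
     (forall x y, mate x y -> P x = Some true \/ P y = Some true) -> black_connected P) ->
  virtual_connection S.
Proof.
move=> mC mI mF conn; rewrite /virtual_connection.
have: forall x, x \in S -> stones S x = Some true by move=> x; rewrite /stones => ->.
have: forall x y, mate x y -> stones S x = Some false -> stones S y = Some true.
  by move=> x y _; rewrite /stones; case: (x \in S).
move: (stones S) => P; have [m] := ubnP #|empties P|.
elim: m P => // m IH P /ltnSE-le PM PS.
have win Q : full Q -> (forall x y, mate x y -> Q x = Some false -> Q y = Some true) ->
    (forall x, x \in S -> Q x = Some true) -> black_connected Q.
  move=> fQ QM QS; apply: conn => // x y xy.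
  by case Ex: (Q x) => [[]|]; [left|right; apply: QM xy Ex|case: (fQ x)].
have [fP|[z0 Pz0]] := full_or_empty P; first by apply: bw_end (win P fP PM PS).
apply: bw_white => [/(_ z0)//|y Py]; set P1 := place P y false.
have lt1 : #|empties P1| < #|empties P| := card_empties_place false Py.
have P1o x c : P x = Some c -> P1 x = Some c.
  by move=> Px; rewrite /P1 place_other //; apply: contra_eq_neq Px => ->; rewrite Py.
have P1S x : x \in S -> P1 x = Some true by move=> /PS/P1o.
have PyN x : mate y x -> P x <> Some false.
  by rewrite mC => xy /(PM _ _ xy); rewrite Py.
have go z : P1 z = None -> (forall x, mate y x -> place P1 z true x = Some true) ->
    black_wins (place P1 z true) false.
  move=> P1z yz; apply: IH.
  - by apply: leq_trans (card_empties_place true P1z) _; apply: leq_trans (ltnW lt1) le.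
  - move=> a b ab /placeP[[]|/placeP[[ay _]|Pa]] //; first by apply: yz; rewrite -ay.
    by rewrite /place; case: eqP => // _; apply/P1o/(PM _ _ ab Pa).
  - by move=> x xS; rewrite /place; case: eqP => // _; apply: P1S.
have yx x : mate y x -> x != y by apply: contraTneq => ->; rewrite mI.
have [fP1|[z1 P1z1]] := full_or_empty P1.
  apply: bw_end (win P1 fP1 _ P1S) => // a b ab /placeP[[ay _]|Pa]; last exact/P1o/(PM _ _ ab Pa).
  subst a; have := fP1 b; rewrite /P1 place_other ?yx //.
  by have := PyN b ab; case: (P b) => [[]|].
apply: bw_black => [/(_ z1)//|].
case: (pickP (fun b => mate y b && (P1 b == None))) => [b /andP[yb /eqP P1b]|nob].
  exists b; split=> //; apply: go => // x yx'; rewrite (mF _ _ _ yx' yb); exact: place_same.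
exists z1; split=> //; apply: go => // x yx'.
have /negbT := nob x; rewrite yx' /= => Px.
rewrite /place; case: (x =P z1) => // _.
move: Px (PyN _ yx'); rewrite /P1 place_other ?yx //.
by case: (P x) => [[]|].
Qed.

(* Pairing for the template between the stone (1,2) and the left edge. *)
Definition ziggurat (r c : nat) : nat * nat :=
  match r, c with
  | 0, 0 => (1, 0) | 1, 0 => (0, 0) | 2, 0 => (3, 0) | 3, 0 => (2, 0)
  | 0, 1 => (2, 1) | 2, 1 => (0, 1) | 1, 1 => (0, 2) | 0, 2 => (1, 1)
  | _, _ => (r, c)
  end.

(** The first two clauses pair the common neighbours of the stones [(1, 3i+2)] and [(2, 3i+3)], the
    next two those of [(2, 3i)] and [(1, 3i+2)]. In the last column these two clauses also link the
    last stone to the edge if [n %% 3 = 2], and the fifth clause does so if [n %% 3 = 1]. If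
    [n %% 3 = 0], the last stone is farther away and [partner] uses the rotated template. *)
Definition bridge (n r c : nat) : nat * nat :=
  if (r == 2) && (c %% 3 == 2) && (c + 3 <= n) then (1, c.+1)
  else if (r == 1) && (c %% 3 == 0) && (c + 2 <= n) then (2, c.-1)
  else if (c %% 3 == 1) && (r == 2) then (1, c)
  else if (c %% 3 == 1) && (r == 1) then (2, c)
  else if (n %% 3 == 1) && (c.+1 == n) && (r <= 1) then (1 - r, c)
  else (r, c).

Definition corner (r c : nat) : bool := (c <= 1) || (c == 2) && (r == 0).

(* Cells without a partner are mapped to themselves. *)
Definition partner (n r c : nat) : nat * nat :=
  if corner r c then ziggurat r c
  else if (n %% 3 == 0) && corner (3 - r) (n - c.+1) then
    let p := ziggurat (3 - r) (n - c.+1) in (3 - p.1, n - p.2.+1)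
  else bridge n r c.

Lemma ziggurat_corner r c : r < 4 -> corner r c ->
  exists r' c', [/\ ziggurat r c = (r', c'), ziggurat r' c' = (r, c), r' < 4, c' <= 2 & corner r' c'].
Proof.
move=> r4 rc; exists (ziggurat r c).1, (ziggurat r c).2.
by case: r c r4 rc => [|[|[|[|r]]]] [|[|[|c]]].
Qed.

(** Each clause lands in the clause that undoes it, without entering a corner, so that [partner] can
    be inverted region by region. *)
Lemma bridgeK n r c : 4 <= n -> r < 4 -> c < n -> ~~ corner r c ->
  ~~ ((n %% 3 == 0) && corner (3 - r) (n - c.+1)) -> exists r' c',
  [/\ bridge n r c = (r', c'), bridge n r' c' = (r, c), r' < 4, c' < n &
      ~~ corner r' c' /\ ~~ ((n %% 3 == 0) && corner (3 - r') (n - c'.+1))].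
Proof.
move=> n4 r4 cn; rewrite {1}/bridge.
have [/andP[/andP[/eqP-> c2] cn3]|h1] := boolP (_ && _ && _).
  move=> k1 k2; exists 1, c.+1; rewrite /bridge.
  have -> : (1 == 2) && (c.+1 %% 3 == 2) && (c.+1 + 3 <= n) = false by [].
  have -> : (1 == 1) && (c.+1 %% 3 == 0) && (c.+1 + 2 <= n) by lia.
  by split=> //; [lia|move: k1 k2; rewrite /corner; lia].
have [/andP[/andP[/eqP-> c0] cn2]|h2] := boolP (_ && _ && _).
  move=> k1 k2; exists 2, c.-1; rewrite /bridge.
  have -> : (2 == 2) && (c.-1 %% 3 == 2) && (c.-1 + 3 <= n) by move: k1; rewrite /corner; lia.
  by split=> //; [congr pair|..]; move: k1 k2; rewrite /corner; lia.
have [/andP[c1 /eqP->]|h3] := boolP ((c %% 3 == 1) && (r == 2)).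
  move=> k1 k2; exists 1, c; rewrite /bridge c1 /=.
  have -> : (c %% 3 == 0) && (c + 2 <= n) = false by lia.
  by split=> //; move: k1 k2; rewrite /corner; lia.
have [/andP[c1 /eqP->]|h4] := boolP ((c %% 3 == 1) && (r == 1)).
  move=> k1 k2; exists 2, c; rewrite /bridge c1 /=.
  have -> : (c %% 3 == 2) && (c + 3 <= n) = false by lia.
  by split=> //; move: k1 k2; rewrite /corner; lia.
have [/andP[/andP[n1 cn1] r1]|h5] := boolP (_ && _ && _).
  move=> k1 k2; exists (1 - r), c; rewrite /bridge n1 cn1 /=.
  have -> : (1 - r == 2) = false by lia.
  have -> : (c %% 3 == 1) = false by lia.
  have -> : (1 - r == 1) && (c %% 3 == 0) && (c + 2 <= n) = false by lia.
  have -> : 1 - r <= 1 by lia.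
  by split=> //=; [congr pair|..]; move: k1 k2; rewrite /corner; lia.
move=> k1 k2; exists r, c; split=> //.
by rewrite /bridge (negbTE h1) (negbTE h2) (negbTE h3) (negbTE h4) (negbTE h5).
Qed.

Lemma partnerK n r c : 4 <= n -> r < 4 -> c < n -> exists r' c',
  [/\ partner n r c = (r', c'), partner n r' c' = (r, c), r' < 4 & c' < n].
Proof.
move=> n4 r4 cn; rewrite /partner; case: (boolP (corner r c)) => [rc|nrc].
  have [r' [c' [-> e r'4 c'2 rc']]] := ziggurat_corner r4 rc.
  by exists r', c'; rewrite rc' e; split=> //; lia.
case: (boolP (_ && _)) => [/andP[n3 rc]|nrot].
  have r4' : 3 - r < 4 by lia.
  have [r' [c' [-> e r'4 c'2 rc']]] := ziggurat_corner r4' rc.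
  exists (3 - r'), (n - c'.+1) => /=.
  (* Here [n] is a multiple of 3 and at least 6, so the two corners are disjoint. *)
  have -> : corner (3 - r') (n - c'.+1) = false by move: rc rc' nrc; rewrite /corner; lia.
  have -> : 3 - (3 - r') = r' by lia.
  have -> : n - (n - c'.+1).+1 = c' by lia.
  rewrite n3 rc' e /=; split=> //; try lia.
  by congr pair; lia.
have [r' [c' [-> e r'4 c'n [ncor nrot']]]] := bridgeK n4 r4 cn nrc nrot.
by exists r', c'; rewrite (negbTE ncor) (negbTE nrot') e.
Qed.

Definition is_stone (n r c : nat) : bool :=
  (2 <= c) && (c + 2 <= n) && ((r == 1) && (c %% 3 == 2) || (r == 2) && (c %% 3 == 0)).

Definition stone_set (n : nat) : {set cell n} := [set x : cell n | is_stone n x.1 x.2].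

(** * The chain through the stones in a full position *)

Section Connection.
Variable n : nat.
Hypothesis n4 : 4 <= n.

Definition partners (x y : cell n) : bool :=
  (partner n x.1 x.2 != (x.1 : nat, x.2 : nat)) && (partner n x.1 x.2 == (y.1 : nat, y.2 : nat)).

Lemma cell_eqP (x y : cell n) : x.1 = y.1 :> nat -> x.2 = y.2 :> nat -> x = y.
Proof. by case: x y => [a b] [a' b'] /= e1 e2; congr pair; apply: val_inj. Qed.

Lemma partners_sym : symmetric partners.
Proof.
suff H x y : partners x y -> partners y x by move=> x y; apply/idP/idP; apply: H.
rewrite /partners.
have [r' [c' [-> e' _ _]]] := partnerK n4 (ltn_ord x.1) (ltn_ord x.2).
by case/andP=> ne /eqP[e1 e2]; rewrite -e1 -e2 e' eqxx andbT eq_sym.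
Qed.

Lemma partners_irr : irreflexive partners.
Proof. by move=> x; rewrite /partners andNb. Qed.

Lemma partners_fun x y z : partners x y -> partners x z -> y = z.
Proof.
rewrite /partners => /andP[_ /eqP->] /andP[_ /eqP[e1 e2]].
exact: cell_eqP.
Qed.

Section Full.
Variable P : position n.
Hypothesis stone_black : forall x, x \in stone_set n -> P x = Some true.
Hypothesis partner_black : forall x y, partners x y -> P x = Some true \/ P y = Some true.

Definition black_at (r c : nat) : Prop :=
  exists x : cell n, [/\ x.1 = r :> nat, x.2 = c :> nat & P x = Some true].

Definition black_adj (a b : cell n) : bool :=
  (P a == Some true) && (P b == Some true) && hex_adj a b.

Definition reached (r c : nat) : Prop :=
  exists x y : cell n, [/\ P x = Some true, x.2 = 0 :> nat, y.1 = r :> nat, y.2 = c :> nat &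
                           P y = Some true /\ connect black_adj x y].

Lemma stone_at r c : r < 4 -> c < n -> is_stone n r c -> black_at r c.
Proof.
move=> r4 cn s; exists (Ordinal r4, Ordinal cn); split=> //.
by apply: stone_black; rewrite inE.
Qed.

Lemma partner_at r c r' c' : r < 4 -> c < n -> partner n r c = (r', c') ->
  (r, c) != (r', c') -> black_at r c \/ black_at r' c'.
Proof.
move=> r4 cn e ne; have [r'' [c'' []]] := partnerK n4 r4 cn.
rewrite e => -[<- <-] _ r4' cn'.
pose x : cell n := (Ordinal r4, Ordinal cn); pose y : cell n := (Ordinal r4', Ordinal cn').
have xy : partners x y by rewrite /partners /= e eqxx andbT eq_sym.
by case: (partner_black xy) => h; [left; exists x|right; exists y].
Qed.

Lemma reached0 r : black_at r 0 -> reached r 0.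
Proof. by case=> x [xr x0 Px]; exists x, x; rewrite connect0. Qed.

(** The formula of [hex_adj] on plain numbers, so that adjacency of given coordinates is settled by
    computation or [lia]. *)
Definition near r1 c1 r2 c2 : bool :=
  [|| (r1 == r2) && ((c1 == c2.+1) || (c2 == c1.+1)),
      (c1 == c2) && ((r1 == r2.+1) || (r2 == r1.+1)),
      (r1 == r2.+1) && (c2 == c1.+1)
    | (r2 == r1.+1) && (c1 == c2.+1)].

Lemma reached_near r c r' c' : reached r c -> black_at r' c' -> near r c r' c' -> reached r' c'.
Proof.
case=> x [y [Px x0 yr yc [Py xy]]] [z [zr zc Pz]] yz; exists x, z; split=> //; split=> //.
apply: connect_trans xy (connect1 _).
by rewrite /black_adj Py Pz /hex_adj yr yc zr zc.
Qed.

(** Each of the four pairs of the template has a black cell; in all sixteen cases one of the seven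
    listed paths leads from column 0 to the stone. *)
Lemma left_end : reached 1 2.
Proof.
have s : black_at 1 2 by apply: stone_at; rewrite ?/is_stone //; lia.
have n0 : 0 < n by lia. have n1 : 1 < n by lia. have n2 : 2 < n by lia.
have step r c r' c' : near r c r' c' -> reached r c -> black_at r' c' -> reached r' c'.
  by move=> a h b; apply: reached_near h b a.
case: (@partner_at 0 0 1 0 isT n0 erefl isT) => [b00|b10];
case: (@partner_at 2 0 3 0 isT n0 erefl isT) => [b20|b30];
case: (@partner_at 0 1 2 1 isT n1 erefl isT) => [b01|b21];
case: (@partner_at 0 2 1 1 isT n2 erefl isT) => [b02|b11];
first [ exact: step 1 1 1 2 isT (step 1 0 1 1 isT (reached0 b10) b11) s
      | exact: step 1 1 1 2 isT (step 2 0 1 1 isT (reached0 b20) b11) s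
      | exact: step 2 1 1 2 isT (step 3 0 2 1 isT (reached0 b30) b21) s
      | exact: step 2 1 1 2 isT (step 2 0 2 1 isT (reached0 b20) b21) s
      | exact: step 1 1 1 2 isT (step 0 1 1 1 isT (step 0 0 0 1 isT (reached0 b00) b01) b11) s
      | exact: step 0 2 1 2 isT (step 0 1 0 2 isT (step 0 0 0 1 isT (reached0 b00) b01) b02) s
      | exact: step 0 2 1 2 isT (step 0 1 0 2 isT (step 1 0 0 1 isT (reached0 b10) b01) b02) s ].
Qed.

(** The argument of [left_end] turned by 180 degrees: [rotated] carries the pairs of [ziggurat] over
    to the last three columns, and the paths run from the stone [(2, m)] to the edge. *)
Lemma right_end m : n = m + 3 -> m %% 3 = 0 -> 3 <= m -> reached 2 m ->
  exists r, reached r n.-1.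
Proof.
move=> nm m3 m_ge h.
have step r c r' c' : near r c r' c' -> reached r c -> black_at r' c' -> reached r' c'.
  by move=> a b d; apply: reached_near b d a.
have rotated r c r' c' : r < 4 -> m <= c -> c < n -> corner (3 - r) (n - c.+1) ->
    ziggurat (3 - r) (n - c.+1) = (3 - r', n - c'.+1) -> r' < 4 -> c' < n ->
    (r, c) != (r', c') -> black_at r c \/ black_at r' c'.
  move=> r4 mc cn cor e r4' cn' ne; apply: partner_at => //.
  rewrite /partner cor e /= andbT.
  have -> : corner r c = false by rewrite /corner; lia.
  have -> : n %% 3 == 0 by lia.
  by congr pair; lia.
have e0 : n - m.+3 = 0 by lia.
have e1 : n - m.+2 = 1 by lia.
have e2 : n - m.+1 = 2 by lia.
have -> : n.-1 = m.+2 by lia.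
have l0 : m < n by lia. have l1 : m.+1 < n by lia. have l2 : m.+2 < n by lia.
have ge1 : m <= m.+1 by lia. have ge2 : m <= m.+2 by lia.
have ne r c r' c' : r != r' -> (r, c) != (r', c') :> nat * nat by apply: contra_neq => -[].
have A : black_at 3 m \/ black_at 2 m.+1 by apply: rotated; rewrite ?e1 ?e2 ?ne.
have C : black_at 3 m.+1 \/ black_at 1 m.+1 by apply: rotated; rewrite ?e1 ?ne.
have E : black_at 3 m.+2 \/ black_at 2 m.+2 by apply: rotated; rewrite ?e0 ?ne.
have G : black_at 1 m.+2 \/ black_at 0 m.+2 by apply: rotated; rewrite ?e0 ?ne.
have nr r c r' c' : [\/ r = r' /\ c' = c.+1, c = c' /\ r' = r.+1 | r = r'.+1 /\ c' = c.+1] ->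
    near r c r' c' by rewrite /near => -[] []; lia.
have hor r c : near r c r c.+1 by apply: nr; constructor 1.
have down r c : near r c r.+1 c by apply: nr; constructor 2.
have up r c : near r.+1 c r c.+1 by apply: nr; constructor 3.
case: A => [bA|bB]; case: C => [bC|bD]; case: E => [bE|bF]; case: G => [bG|bH];
first [ exists 2; exact: step (hor _ _) (step _ _ _ _ (hor _ _) h bB) bF
      | exists 1; exact: step (up _ _) (step _ _ _ _ (hor _ _) h bB) bG
      | exists 1; exact: step (hor _ _) (step _ _ _ _ (up _ _) h bD) bG
      | exists 0; exact: step (up _ _) (step _ _ _ _ (up _ _) h bD) bH
      | exists 3; exact: step (hor _ _) (step _ _ _ _ (down _ _) (step _ _ _ _ (hor _ _) h bB) bC) bE
      | exists 3; exact: step (hor _ _) (step _ _ _ _ (hor _ _) (step _ _ _ _ (down _ _) h bA) bC) bE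
      | exists 2; exact: step (up _ _) (step _ _ _ _ (hor _ _) (step _ _ _ _ (down _ _) h bA) bC) bF ].
Qed.

Lemma bridge_at r c r' c' : r < 4 -> c < n -> ~~ corner r c ->
  ~~ ((n %% 3 == 0) && corner (3 - r) (n - c.+1)) ->
  bridge n r c = (r', c') -> r != r' -> black_at r c \/ black_at r' c'.
Proof.
move=> r4 cn nc nr e ne; apply: partner_at => //; last by apply: contra_neq ne => -[].
by rewrite /partner (negbTE nc) (negbTE nr).
Qed.

(** Induction along the chain: the previous stone lies two columns back if [c %% 3 = 2] and one
    column back if [c %% 3 = 0], and the pair between the two stones contains a black cell adjacent
    to both. *)
Lemma stones_reached c : 2 <= c -> c + 2 <= n ->
  (c %% 3 = 2 -> reached 1 c) /\ (c %% 3 = 0 -> reached 2 c).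
Proof.
elim/ltn_ind: c => c IH c2 cn; split=> cm.
  have [->|c5] : c = 2 \/ 5 <= c by lia.
    exact: left_end.
  have [|||_ h] := IH (c - 2); [lia..|]; have {}h := h ltac:(lia).
  have s : black_at 1 c by apply: stone_at; rewrite ?/is_stone; lia.
  have l : c.-1 < n by lia.
  have nc : ~~ corner 2 c.-1 by rewrite /corner; lia.
  have nr : ~~ ((n %% 3 == 0) && corner (3 - 2) (n - c.-1.+1)) by rewrite /corner; lia.
  have e : bridge n 2 c.-1 = (1, c.-1).
    rewrite /bridge; have -> : (2 == 2) && (c.-1 %% 3 == 2) && (c.-1 + 3 <= n) = false by lia.
    by have -> : (c.-1 %% 3 == 1) by lia.
  have [b|b] := @bridge_at 2 c.-1 1 _ isT l nc nr e isT;
    by apply: reached_near (reached_near h b _) s _; rewrite /near; lia.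
have [|||h _] := IH c.-1; [lia..|]; have {}h := h ltac:(lia).
have s : black_at 2 c by apply: stone_at; rewrite ?/is_stone; lia.
have l : c.-1 < n by lia.
have nc : ~~ corner 2 c.-1 by rewrite /corner; lia.
have nr : ~~ ((n %% 3 == 0) && corner (3 - 2) (n - c.-1.+1)) by rewrite /corner; lia.
have e : bridge n 2 c.-1 = (1, c.-1.+1).
  by rewrite /bridge; have -> : (2 == 2) && (c.-1 %% 3 == 2) && (c.-1 + 3 <= n) by lia.
have [b|b] := @bridge_at 2 c.-1 1 _ isT l nc nr e isT;
  by apply: reached_near (reached_near h b _) s _; rewrite /near; lia.
Qed.

Lemma right_reached : exists r, reached r n.-1.
Proof.
have ln : n.-1 < n by lia.
have last_pair r r' s : r < 4 -> r != r' -> bridge n r n.-1 = (r', n.-1) ->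
    n %% 3 != 0 -> reached s (n - 2) -> near s (n - 2) r n.-1 -> near s (n - 2) r' n.-1 ->
    exists r, reached r n.-1.
  move=> r4 ne e n3 h n1 n2; have [||b|b] := bridge_at r4 ln _ _ e ne.
  - by rewrite /corner; lia.
  - by rewrite (negbTE n3).
  - by exists r; apply: reached_near h b n1.
  - by exists r'; apply: reached_near h b n2.
(* For residue 0 the last stone is in column [n - 3] and the template is needed; otherwise it is in
   column [n - 2], adjacent to both cells of a pair in the last column. *)
have [n0|[n1|n2]] : n %% 3 = 0 \/ n %% 3 = 1 \/ n %% 3 = 2 by lia.
- apply: (@right_end (n - 3)); [lia..|].
  by have [||_] := @stones_reached (n - 3); [lia..|apply; lia].
- have [||h _] := @stones_reached (n - 2); [lia..|].
  apply: (last_pair 1 0 1); rewrite ?/near //; try lia; last by apply: h; lia.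
  rewrite /bridge n1; have -> : (n.-1 %% 3 == 0) && (n.-1 + 2 <= n) = false by lia.
  have -> : (n.-1 %% 3 == 1) = false by lia.
  by have -> : n.-1.+1 == n by lia.
- have [||_ h] := @stones_reached (n - 2); [lia..|].
  apply: (last_pair 2 1 2); rewrite ?/near //; try lia; last by apply: h; lia.
  rewrite /bridge; have -> : (2 == 2) && (n.-1 %% 3 == 2) && (n.-1 + 3 <= n) = false by lia.
  by have -> : n.-1 %% 3 == 1 by lia.
Qed.

Lemma stones_connect : black_connected P.
Proof.
have [r [x [y [Px x0 _ yn [Py xy]]]]] := right_reached.
by exists x, y.
Qed.

End Full.

Lemma stone_set_wins : virtual_connection (stone_set n).
Proof.
apply: (pairing_wins partners_sym partners_irr partners_fun) => P _ PS PM.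
exact: stones_connect PS PM.
Qed.

End Connection.

(** * The number of stones *)

Lemma count_stone_columns m : 2 <= m ->
  count (fun c => (2 <= c) && (c %% 3 != 1)) (iota 0 m) = (2 * m - 2) %/ 3.
Proof.
elim: m => // m IH; rewrite leq_eqVlt => /predU1P[<-//|m2].
by rewrite -[in iota _ _]addn1 iotaD count_cat IH //= add0n; case: eqP => h; lia.
Qed.

Lemma card_stone_set n : 4 <= n -> #|stone_set n| = (2 * n - 4) %/ 3.
Proof.
move=> n4; pose row (c : 'I_n) : 'I_4 := if c %% 3 == 2 then inord 1 else inord 2.
pose p c := [&& 2 <= c, c + 2 <= n & c %% 3 != 1].
have rowE c : row c = (if c %% 3 == 2 then 1 else 2) :> nat.
  by rewrite /row; case: ifP => _; rewrite inordK.
have -> : stone_set n = [set (row c, c) | c : 'I_n & p c].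
  apply/setP => -[r c]; rewrite !inE /is_stone /=; apply/idP/imsetP => [h|[d]].
    exists c; first by rewrite inE /p; lia.
    by congr pair; apply: ord_inj; rewrite rowE; case: eqP; lia.
  by rewrite inE /p => h [-> ->]; move: h; rewrite rowE; case: (d %% 3 =P 2) => /=; lia.
rewrite card_imset => [|a b []//]; rewrite cardsE -sum1_card.
rewrite -(big_mkord p (fun _ => 1)) sum1_count /index_iota subn0.
(* Splitting off the last column, where [p] fails, leaves only columns that satisfy [c + 2 <= n]. *)
have -> : n = n.-1 + 1 by lia.
rewrite iotaD count_cat /= add0n.
have -> : p n.-1 = false by rewrite /p; lia.
rewrite (@eq_in_count _ _ (fun c => (2 <= c) && (c %% 3 != 1))); last first.
  by move=> c; rewrite mem_iota /p => h; lia.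
by rewrite count_stone_columns; lia.
Qed.

(** * White's strategies in a window *)

(* A set of cells of a window is a binary number: bit [4 * c + r] stands for row
   [r] of column [c].  The two constants cover windows of up to 14 columns. *)
Definition top_row : N := 0x11111111111111.
Definition bottom_row : N := 0x88888888888888.

Definition full_mask (w : nat) : N := N.ones (N.of_nat (4 * w)).

(** The shifts by 4, 1 and 3 are the six directions of the hexagonal grid. Row 0 or row 3 is removed
    first wherever a change of row would wrap around into another column. *)
Definition nb (m : N) : N :=
  let u := N.ldiff m top_row in let d := N.ldiff m bottom_row in
  N.lor (N.shiftl m 4) (N.lor (N.shiftr m 4) (N.lor (N.shiftr u 1)
    (N.lor (N.shiftl d 1) (N.lor (N.shiftr d 3) (N.shiftl u 3))))).

Fixpoint low_pos (p : positive) : positive :=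
  match p with xH => xH | xO q => xO (low_pos q) | xI _ => xH end.

Definition low (m : N) : N := if m is Npos p then Npos (low_pos p) else N0.

(* Here and below, running out of fuel can only make a check fail. *)
Fixpoint flood (fuel : nat) (m s : N) : N :=
  if fuel is k.+1 then
    let m' := N.land (N.lor m (nb m)) s in
    if N.eqb m' m then m else flood k m' s
  else m.

Fixpoint find_pair (fuel : nat) (m : N) : option (N * N) :=
  if fuel is k.+1 then
    if m is N0 then None else
    let a := low m in let b := low (N.land (nb a) m) in
    if b is N0 then find_pair k (N.ldiff m a) else Some (a, b)
  else None.

Fixpoint find_group (fuel : nat) (lib rest r : N) : option (N * (N * N)) :=
  if fuel is k.+1 then
    if r is N0 then None else
    let g := flood 40 (low r) rest in
    if find_pair 9 (N.land (nb g) lib) is Some p then Some (g, p)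
    else find_group k lib rest (N.ldiff r g)
  else None.

(* Extends the white group [grp], which touches the top edge, down to the bottom
   edge through pairs of free common neighbours of groups.  This is a greedy
   guess: nothing is proved about it, and [barrier] verifies its outcome. *)
Fixpoint bridges (fuel : nat) (e grp rest : N) (q : seq (N * N)) : option (seq (N * N)) :=
  if fuel is k.+1 then
    if N.land grp bottom_row is Npos _ then Some q else
    let lib := N.land (N.lor (nb grp) top_row) e in
    if find_pair 9 (N.land lib bottom_row) is Some p then Some (p :: q) else
    if find_group 20 lib rest rest is Some (g, p) then
      bridges k (N.ldiff e (N.lor p.1 p.2)) (N.lor grp g) (N.ldiff rest g) (p :: q)
    else None
  else None.

Definition cross_step (p : N * N) (l : N) : N :=
  N.lor (if N.land l p.1 is N0 then N0 else N.ldiff (nb p.1) p.2)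
        (if N.land l p.2 is N0 then N0 else N.ldiff (nb p.2) p.1).

Definition pair_cells (q : seq (N * N)) : N :=
  foldr (fun p m => N.lor (N.lor p.1 p.2) m) N0 q.

(* What Black can reach from the left column within [s] if he gets at most one
   cell of each pair of [q]: he cannot pass directly between the two cells. *)
Definition leak_step (s qc : N) (q : seq (N * N)) (l : N) : N :=
  N.land (N.lor l (foldr (fun p m => N.lor (cross_step p l) m) (nb (N.ldiff l qc)) q)) s.

Fixpoint leak (fuel : nat) (s qc : N) (q : seq (N * N)) (l : N) : N :=
  if fuel is k.+1 then
    let l' := leak_step s qc q l in if N.eqb l' l then l else leak k s qc q l'
  else l.

Definition single (w : nat) (b : N) : bool :=
  [&& b != N0, b == low b & N.ldiff b (full_mask w) == N0].

(** The first three conditions state directly that [l] misses the last column, contains the first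
    one outside [W], and is closed under [leak_step]; thus nothing about [leak] or its fuel has to
    be proved. The last two make the pairs disjoint pairs of cells. *)
Definition barrier (w : nat) (W : N) (q : seq (N * N)) : bool :=
  let s := N.ldiff (full_mask w) W in
  let qc := pair_cells q in
  let l := leak 40 s qc q (N.land 15 s) in
  [&& N.land l (N.shiftl 15 (N.of_nat (4 * w.-1))) == N0,
      N.ldiff (N.land 15 s) l == N0,
      N.ldiff (leak_step s qc q l) l == N0,
      all (fun p => single w p.1 && single w p.2) q
    & uniq (map fst q ++ map snd q)].

(** A white stone on such a cell joins the two long edges: on either side it touches the edge or a
    white group attached to it. *)
Definition winning (w : nat) (B W : N) : N :=
  N.land (N.land (N.lor (nb (flood 40 (N.land W top_row) W)) top_row)
                 (N.lor (nb (flood 40 (N.land W bottom_row) W)) bottom_row))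
         (N.ldiff (N.ldiff (full_mask w) B) W).

Definition bridged (w : nat) (B W : N) : option (seq (N * N)) :=
  let top := flood 40 (N.land W top_row) W in
  if bridges 9 (N.ldiff (N.ldiff (full_mask w) B) W) top (N.ldiff W top) [::] is Some q
  then if barrier w W q then Some q else None else None.

Fixpoint replies (solve : N -> seq N -> option (N * seq N)) (j : nat) (r c : N) (h : seq N) :
    option (N * seq N) :=
  if r is N0 then Some (c, h) else
  if j is j'.+1 then
    if solve (low r) h is Some (c', h) then replies solve j' (N.land r c') (N.lor c c') h
    else None
  else None.

Definition next_move (w : nat) (B W : N) (h : seq N) : N * seq N :=
  let v := winning w B W in if v is N0 then (head N0 h, behead h) else (low v, h).

(* White owns [W] and is to move; [h] lists his moves, except those that complete
   a chain.  The result is the carrier of his winning strategy and the rest of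
   [h].  The strategy works whenever no cell of the carrier is black; [B], the
   black stones placed so far, only serves to find the next moves.  A reply
   outside the carrier of one continuation is already refuted by it, so Black's
   replies are tried only in the intersection [r] of the carriers so far. *)
Fixpoint strategy (fuel w : nat) (B W : N) (h : seq N) : option (N * seq N) :=
  if fuel is k.+1 then
    let (x, h) := next_move w B W h in
    let W := N.lor W x in
    if single w x then
      if bridged w B W is Some q then Some (N.lor x (pair_cells q), h) else
      if strategy k w B W h is Some (c, h) then
        if replies (fun y => strategy k w (N.lor B y) W) 40 c c h is Some (c, h)
        then Some (N.lor x c, h) else None
      else None
    else None
  else None.

(** * Specifications of the bit operations *)

Lemma uniq_map_inj (T U : eqType) (f : T -> U) (s : seq T) :
  uniq (map f s) -> {in s &, injective f}.
Proof.
elim: s => //= a s IH /andP[na us] x y; rewrite !inE.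
case/predU1P=> [->|xs]; case/predU1P=> [->|ys] // e; [|  |exact: IH].
- by rewrite e map_f in na.
- by rewrite -e map_f in na.
Qed.

Lemma low_bit m : m != N0 -> exists k : nat, low m = N.shiftl 1 (N.of_nat k).
Proof.
case: m => // p _ /=; elim: p => [p _|p [k IH]|]; [by exists 0| |by exists 0].
exists k.+1; rewrite Nnat.Nat2N.inj_succ.
change (N.double (N.pos (low_pos p)) = N.shiftl 1 (N.succ (N.of_nat k))).
by rewrite N.shiftl_succ_r IH.
Qed.

Lemma testbit_bit k m : N.testbit (N.shiftl 1 (N.of_nat k)) (N.of_nat m) = (m == k).
Proof.
rewrite N.shiftl_1_l; case: eqP => [->|ne]; first exact: N.pow2_bits_true.
apply: N.pow2_bits_false; lia.
Qed.

Lemma testbit_full w k : N.testbit (full_mask w) (N.of_nat k) = (k < 4 * w).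
Proof.
rewrite /full_mask; case: ltnP => h; first by apply: N.ones_spec_low; lia.
by apply: N.ones_spec_high; lia.
Qed.

Lemma testbit_column k : N.testbit 15 (N.of_nat k) = (k < 4).
Proof. exact: (testbit_full 1). Qed.

Lemma testbit_top_row k : k < 56 -> N.testbit top_row (N.of_nat k) = (k %% 4 == 0).
Proof.
have H : all (fun i => N.testbit top_row (N.of_nat i) == (i %% 4 == 0)) (iota 0 56) by vm_compute.
by move=> kl; apply/eqP; apply: (allP H); rewrite mem_iota.
Qed.

Lemma testbit_bottom_row k : k < 56 -> N.testbit bottom_row (N.of_nat k) = (k %% 4 == 3).
Proof.
have H : all (fun i => N.testbit bottom_row (N.of_nat i) == (i %% 4 == 3)) (iota 0 56) by vm_compute.
by move=> kl; apply/eqP; apply: (allP H); rewrite mem_iota.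
Qed.

Lemma testbit_shiftl m s k :
  N.testbit (N.shiftl m (N.of_nat s)) (N.of_nat k) =
  (s <= k) && N.testbit m (N.of_nat (k - s)).
Proof.
case: leqP => sk; last by apply: N.shiftl_spec_low; lia.
rewrite N.shiftl_spec_high'; last by lia.
by rewrite /= Nnat.Nat2N.inj_sub.
Qed.

Lemma testbit_shiftr m s k :
  N.testbit (N.shiftr m (N.of_nat s)) (N.of_nat k) = N.testbit m (N.of_nat (k + s)).
Proof. by rewrite N.shiftr_spec' Nnat.Nat2N.inj_add. Qed.

Lemma testbit_nb m k :
  let bit m k := N.testbit m (N.of_nat k) in
  let u := N.ldiff m top_row in let d := N.ldiff m bottom_row in
  bit (nb m) k = [|| (4 <= k) && bit m (k - 4), bit m (k + 4), bit u (k + 1),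
                     (1 <= k) && bit d (k - 1), bit d (k + 3) | (3 <= k) && bit u (k - 3)].
Proof.
move=> bit u d; rewrite /bit /nb -/u -/d !N.lor_spec.
rewrite (testbit_shiftl m 4) (testbit_shiftr m 4) (testbit_shiftr u 1).
by rewrite (testbit_shiftl d 1) (testbit_shiftr d 3) (testbit_shiftl u 3).
Qed.

(** * Soundness of White's strategies on a window with first column [o] and width [w] *)

Section Window.
Variables n o w : nat.
Hypotheses (w_gt0 : 0 < w) (w_le : w <= 14) (ow : o + w <= n).
Implicit Types (x y : cell n) (P : position n) (M : N).

Definition inside x := o <= x.2 < o + w.
Definition cell_index x : nat := 4 * (x.2 - o) + x.1.
(** The test [inside x] is essential: the truncated subtraction in [cell_index] sends all columns
    left of the window to its first column. *)
Definition on M x := inside x && N.testbit M (N.of_nat (cell_index x)).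

Lemma on_lor A B x : on (N.lor A B) x = on A x || on B x.
Proof. by rewrite /on N.lor_spec; case: (inside x). Qed.

Lemma on_land A B x : on (N.land A B) x = on A x && on B x.
Proof. by rewrite /on N.land_spec; case: (inside x). Qed.

Lemma on_ldiff A B x : on (N.ldiff A B) x = on A x && ~~ on B x.
Proof. by rewrite /on N.ldiff_spec; case: (inside x). Qed.

Lemma on0 x : on N0 x = false.
Proof. by rewrite /on andbF. Qed.

Lemma cell_index_lt x : inside x -> cell_index x < 4 * w.
Proof. by rewrite /inside /cell_index; have := ltn_ord x.1; lia. Qed.

Lemma on_full x : on (full_mask w) x = inside x.
Proof.
by rewrite /on testbit_full; case h: (inside x) => //=; rewrite cell_index_lt.
Qed.

Lemma cell_index_inj x y : inside x -> inside y -> cell_index x = cell_index y -> x = y.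
Proof.
case: x y => [r c] [r' c']; rewrite /inside /cell_index /= => hx hy e.
by have := ltn_ord r; have := ltn_ord r'; move=> h h'; congr pair; apply: val_inj => /=; lia.
Qed.

Lemma ldiff_eq0 A B x : N.ldiff A B == N0 -> on A x -> on B x.
Proof. by move/eqP=> e Ax; apply: contraFT (on0 x) => nB; rewrite -e on_ldiff Ax. Qed.

Lemma land_eq0 A B x : N.land A B == N0 -> on A x -> ~~ on B x.
Proof. by move/eqP=> e Ax; apply: contraFN (on0 x) => Bx; rewrite -e on_land Ax. Qed.

Lemma singleP b : single w b -> exists2 x, inside x & b = N.shiftl 1 (N.of_nat (cell_index x)).
Proof.
case/and3P=> b0 /eqP eb /eqP bf; have [k ek] := low_bit b0; rewrite -eb in ek.
have kw : k < 4 * w.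
  have := congr1 (fun M => N.testbit M (N.of_nat k)) bf.
  by rewrite N.ldiff_spec testbit_full {1}ek testbit_bit eqxx N.bits_0 /=; case: ltnP.
have rk : k %% 4 < 4 by rewrite ltn_mod.
have ck : o + k %/ 4 < n by lia.
exists (Ordinal rk, Ordinal ck); first by rewrite /inside /=; lia.
by rewrite ek; do 2 f_equal; rewrite /cell_index /=; lia.
Qed.

Lemma on_bit x y : inside x -> on (N.shiftl 1 (N.of_nat (cell_index x))) y = (y == x).
Proof.
move=> ix; rewrite /on testbit_bit; apply/andP/eqP => [[iy /eqP e]|->]; last by rewrite eqxx.
exact: cell_index_inj.
Qed.

(** Black's reach has to be bounded from above, so [nb] must miss no neighbour inside the window. *)
Lemma on_nb M x y : on M x -> inside y -> hex_adj x y -> on (nb M) y.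
Proof.
case/andP=> ix Mx iy; rewrite /on iy andTb testbit_nb.
have lx := cell_index_lt ix; have r1 := ltn_ord x.1; have r2 := ltn_ord y.1.
have l56 : cell_index x < 56 by lia.
have m4 : cell_index x %% 4 = x.1 by rewrite /cell_index; lia.
have Mu : x.1 != 0 :> nat -> N.testbit (N.ldiff M top_row) (N.of_nat (cell_index x)).
  by move=> h; rewrite N.ldiff_spec Mx testbit_top_row // m4.
have Md : x.1 != 3 :> nat -> N.testbit (N.ldiff M bottom_row) (N.of_nat (cell_index x)).
  by move=> h; rewrite N.ldiff_spec Mx testbit_bottom_row // m4.
move: (ix) (iy) => /andP[ix1 ix2] /andP[iy1 iy2] /or4P[] /andP[/eqP e].
- case/orP=> /eqP e'.
  + have -> : cell_index y + 4 = cell_index x by rewrite /cell_index; lia.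
    by rewrite Mx orbT.
  + have h4 : 4 <= cell_index y by rewrite /cell_index; lia.
    have -> : cell_index y - 4 = cell_index x by rewrite /cell_index; lia.
    by rewrite h4 Mx.
- case/orP=> /eqP e'.
  + have -> : cell_index y + 1 = cell_index x by rewrite /cell_index; lia.
    by rewrite Mu ?orbT //; lia.
  + have h1 : 1 <= cell_index y by rewrite /cell_index; lia.
    have -> : cell_index y - 1 = cell_index x by rewrite /cell_index; lia.
    by rewrite h1 Md ?orbT //; lia.
- move/eqP=> e'.
  have h3 : 3 <= cell_index y by rewrite /cell_index; lia.
  have -> : cell_index y - 3 = cell_index x by rewrite /cell_index; lia.
  by rewrite h3 Mu ?orbT //; lia.
- move/eqP=> e'.
  have -> : cell_index y + 3 = cell_index x by rewrite /cell_index; lia.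
  by rewrite Md ?orbT //; lia.
Qed.

Lemma on_pair_cells q x :
  on (pair_cells q) x = has (fun p => on p.1 x || on p.2 x) q.
Proof. by elim: q => [|p q IH] /=; rewrite ?on0 // !on_lor IH. Qed.

Definition mate (q : seq (N * N)) x y :=
  has (fun p => on p.1 x && on p.2 y || on p.1 y && on p.2 x) q.

(** If [x] lies in no pair, all its neighbours are added. Otherwise the first pair containing [x]
    adds all neighbours except the other cell of that pair, which [~~ mate q x y] excludes. *)
Lemma on_leak_step s q l x y :
  on l x -> on s y -> hex_adj x y -> ~~ mate q x y -> on (leak_step s (pair_cells q) q l) y.
Proof.
move=> lx sy xy nm; have iy : inside y by case/andP: sy.
rewrite /leak_step on_land sy andbT on_lor; apply/orP; right.
case qx: (on (pair_cells q) x); last first.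
  have : on (nb (N.ldiff l (pair_cells q))) y by apply: (on_nb (x := x)); rewrite ?on_ldiff ?lx ?qx.
  by elim: {nm qx}q (N.ldiff _ _) => //= p q IH M h; rewrite on_lor IH ?orbT.
move: qx nm; rewrite on_pair_cells; move: (nb _) => M.
elim: q => //= p q IH; rewrite /mate /= !negb_or -/(mate q x y) -orbA => h.
rewrite on_lor => /andP[/andP[n1 n2] nq]; apply/orP.
have side (a b : N) : on a x -> ~~ on b y -> on (if N.land l a is N0 then N0 else N.ldiff (nb a) b) y.
  move=> ax nby; have: on (N.land l a) x by rewrite on_land lx.
  case: (N.land l a) => [|m _]; first by rewrite on0.
  by rewrite on_ldiff nby andbT; apply: (on_nb (x := x)).
case: (boolP (on p.1 x)) h n1 n2 => [p1 _ n1 _|_ /= h _ n2].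
  by left; rewrite on_lor side.
case: (boolP (on p.2 x)) h n2 => [p2 _ n2|_ /= h _]; last by right; apply: IH.
by left; rewrite on_lor (side p.2 p.1) ?orbT //; apply: contraNN n2 => ->.
Qed.

Lemma mate_sym q : symmetric (mate q).
Proof. by move=> x y; apply: eq_has => p; rewrite orbC. Qed.

(** By the [uniq] condition a cell occurs only once among all first and second components, so it
    determines its pair and its place in it. *)
Lemma barrier_mate W q : barrier w W q ->
  irreflexive (mate q) /\ forall x y z, mate q x y -> mate q x z -> y = z.
Proof.
case/and5P=> _ _ _ /allP sq; rewrite cat_uniq => /and3P[u1 d u2].
have key a x : a \in map fst q ++ map snd q -> on a x -> a = N.shiftl 1 (N.of_nat (cell_index x)).
  rewrite mem_cat => /orP aq ax.
  have: single w a by case: aq => /mapP[p /sq/andP[s1 s2] ->].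
  by move/singleP=> [y iy e]; move: ax; rewrite e on_bit // => /eqP->.
have k1 p x : p \in q -> on p.1 x -> p.1 = N.shiftl 1 (N.of_nat (cell_index x)).
  by move=> pq; apply: key; rewrite mem_cat map_f.
have k2 p x : p \in q -> on p.2 x -> p.2 = N.shiftl 1 (N.of_nat (cell_index x)).
  by move=> pq; apply: key; rewrite mem_cat map_f ?orbT.
have nd p p' : p \in q -> p' \in q -> p.1 = p'.2 -> False.
  move=> pq pq' e; case/hasP: d; exists p'.2; first exact: map_f.
  by rewrite -e; apply: map_f.
have fst_inj := uniq_map_inj u1; have snd_inj := uniq_map_inj u2.
split=> [x|x y z].
  apply/hasP => -[p pq]; rewrite orbb => /andP[/(k1 _ _ pq) e1 /(k2 _ _ pq) e2].
  by apply: (nd p p); rewrite // e1.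
have done2 (a : N) : on a y -> on a z -> single w a -> y = z.
  by move=> ay az /singleP[t it e]; move: ay az; rewrite e !on_bit // => /eqP-> /eqP->.
case/hasP=> p pq py /hasP[p' pq' pz].
have [/sq/andP[s1 s2] /sq/andP[s1' s2']] := (pq, pq').
case/orP: py => /andP[a1 a2]; case/orP: pz => /andP[b1 b2].
- have e : p = p' by apply: fst_inj => //; rewrite (k1 _ _ pq a1) (k1 _ _ pq' b1).
  by apply: (done2 p.2); rewrite // e.
- by case: (nd p p'); rewrite // (k1 _ _ pq a1) (k2 _ _ pq' b2).
- by case: (nd p' p); rewrite // (k2 _ _ pq a2) (k1 _ _ pq' b1).
- have e : p = p' by apply: snd_inj => //; rewrite (k2 _ _ pq a2) (k2 _ _ pq' b2).
  by apply: (done2 p.1); rewrite // e.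
Qed.

(** A black chain starting at the left edge stays in [S], the cells left of the window or in [l].
    Columns change by at most one per step, so it enters the window through the first column, which
    [l] covers; since [l] misses the last column, the chain cannot get past it. *)
Lemma barrier_blocks W q P : barrier w W q ->
  (forall x, on W x -> P x = Some false) ->
  (forall x y, mate q x y -> ~ (P x = Some true /\ P y = Some true)) ->
  ~ black_connected P.
Proof.
move=> bar PW PM [x [y [Px x0 Py yn]]] /connectP[p pth ey]; subst y.
case/and5P: bar; set s := N.ldiff _ W; set l := leak _ _ _ _ _.
move=> /land_eq0 lr /ldiff_eq0 l0 /ldiff_eq0 lstep _ _.
have left_col z : inside z -> z.2 = o :> nat -> P z = Some true -> on l z.
  move=> iz zo Pz; apply: l0; rewrite on_land on_ldiff on_full iz /= andbC.
  apply/andP; split; first by apply/negP => /PW; rewrite Pz.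
  by rewrite /on iz andTb testbit_column /cell_index; have := ltn_ord z.1; lia.
pose S (z : cell n) := (z.2 < o) || on l z.
have Sx : S x.
  rewrite /S; case: ltnP => // ox; apply: left_col => //; rewrite ?/inside; lia.
have right_out z : on l z -> z.2.+1 < o + w.
  move=> lz; have iz : inside z by case/andP: lz.
  have := lr z lz; rewrite /on iz andTb testbit_shiftl testbit_column.
  move: iz; rewrite /inside /cell_index; have := ltn_ord z.1; lia.
have Sstep a b : S a -> P a = Some true -> P b = Some true -> hex_adj a b -> S b.
  move=> Sa Pa Pb ab.
  have dist : b.2 <= a.2.+1.
    by case/or4P: ab => /andP[/eqP e1]; [case/orP=> /eqP|case/orP=> /eqP|move/eqP|move/eqP]; lia.
  rewrite /S; case: ltnP => //= ob; case/orP: Sa => [ao|la].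
    by apply: left_col => //; rewrite ?/inside; lia.
  have ra := right_out _ la; have ib : inside b by rewrite /inside; lia.
  apply: lstep; apply: (on_leak_step la _ ab).
    by rewrite on_ldiff on_full ib; apply/negP => /PW; rewrite Pb.
  by apply/negP => /PM; apply.
have: S (last x p).
  elim: p x Px {x0} Sx pth Py {yn} => //= z p IH x Px Sx /andP[/andP[/andP[_ /eqP Pz] xz] pth].
  by apply: IH => //; apply: Sstep Sx Px Pz xz.
rewrite /S yn => /orP[|/right_out]; rewrite ?yn; lia.
Qed.
(** Cells outside [W] and [c] are arbitrary, possibly all black, and cells of the carrier [c] may
    already be white. Hence extra white stones on empty cells never hurt. *)
Definition safe W c P :=
  (forall x, on W x -> P x = Some false) /\ (forall x, on c x -> P x <> Some true).

Definition white_first W c := forall P, safe W c P -> ~ black_wins P false.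
Definition white_second W c := forall P, safe W c P -> ~ black_wins P true.

Lemma white_first_single W b c :
  single w b -> white_second (N.lor W b) c -> white_first W (N.lor b c).
Proof.
move=> /singleP[z iz ex] h.
have onx y : on b y = (y == z) by rewrite ex on_bit.
apply: (@white_move n (safe W (N.lor b c)) (safe (N.lor W b) c) z) => //.
- by move=> P [_]; apply; rewrite on_lor onx eqxx.
- move=> P [PW Pc] Pz; split=> y; last by move=> cy; apply: Pc; rewrite on_lor cy orbT.
  by rewrite on_lor onx => /orP[/PW|/eqP->].
- move=> P y [PW Pc] Py; split=> t.
    by move=> /PW Wt; rewrite /place; case: eqP.
  by move=> /Pc ct /placeP[[]|].
Qed.

Lemma white_second_bridged W q : barrier w W q -> white_second W (pair_cells q).
Proof.
move=> bar P [PW Pc]; have [mI mF] := barrier_mate bar.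
apply: (pairing_blocks (W := on W) (@mate_sym q) mI mF) PW _.
  by move=> Q QW QM; apply: barrier_blocks bar QW QM.
move=> x y xy Px; case: (Pc x); rewrite // on_pair_cells.
by apply: sub_has xy => p /orP[/andP[->]|/andP[_ ->]]; rewrite ?orbT.
Qed.

(** Whatever cell [x] Black takes, some carrier [d] avoids it, and the strategy on [d] still works.
    The carrier [c0] serves for a full board, where Black has no move. *)
Lemma white_second_replies W c0 c :
  white_first W c0 ->
  (forall x, exists d, [/\ white_first W d, ~~ on d x & forall z, on d z -> on c z]) ->
  (forall z, on c0 z -> on c z) ->
  white_second W c.
Proof.
move=> w0 wd c0c P [PW Pc] /black_wins_turn[[fP cP]|[_ [y [Py bP]]]].
  apply: (w0 P); last exact: bw_end.
  by split=> // x /c0c/Pc.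
have [d [wwd ndy dc]] := wd y; apply: wwd bP; split=> x.
  by move=> /PW Px; rewrite place_other //; apply: contra_eq_neq Px => ->; rewrite Py.
move=> dx; rewrite place_other; first exact/Pc/dc.
by apply: contraNneq ndy => <-.
Qed.

(** A carrier [d] found for one reply refutes every [x] of [r] outside [d]; the other cells of [r]
    stay in the intersection passed on. Success means that this intersection has become empty, so
    each cell has been avoided by some carrier. *)
Lemma replies_sound (G : N -> Prop) solve j r c h c' h' :
  (forall b h d h', solve b h = Some (d, h') -> G d) ->
  replies solve j r c h = Some (c', h') ->
  (forall z, on c z -> on c' z) /\
  forall x, on r x -> exists d, [/\ G d, ~~ on d x & forall z, on d z -> on c' z].
Proof.
move=> sG; elim: j r c h => [|j IH] [|r] c h /=.
- by case=> <- _; split=> // x; rewrite on0.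
- by [].
- by case=> <- _; split=> // x; rewrite on0.
case E: (solve _ h) => [[d h1]|] // /IH[cc' H].
have {}cc' z : on c z || on d z -> on c' z by rewrite -on_lor; apply: cc'.
split=> [z cz|x rx]; first by apply: cc'; rewrite cz.
case dx: (on d x); first by apply: H; rewrite -[X in on X]/(N.land (N.pos r) d) on_land rx.
exists d; split; [exact: sG E|by rewrite dx|by move=> z dz; apply: cc'; rewrite dz orbT].
Qed.

Lemma strategyS k B W h :
  strategy k.+1 w B W h =
    let (b, h) := next_move w B W h in
    let W := N.lor W b in
    if single w b then
      if bridged w B W is Some q then Some (N.lor b (pair_cells q), h) else
      if strategy k w B W h is Some (c, h) then
        if replies (fun d => strategy k w (N.lor B d) W) 40 c c h is Some (c, h)
        then Some (N.lor b c, h) else None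
      else None
    else None.
Proof. by []. Qed.

Lemma bridged_barrier B W q : bridged w B W = Some q -> barrier w W q.
Proof.
by rewrite /bridged; case: (bridges _ _ _ _ _) => // q0; case: (boolP (barrier w W q0)) => // bar [<-].
Qed.

Lemma strategy_sound fuel B W h c h' :
  strategy fuel w B W h = Some (c, h') -> white_first W c.
Proof.
elim: fuel B W h c h' => [|k IH] B W h c h'; first by [].
rewrite strategyS; case: (next_move w B W h) => b h1; cbv zeta iota.
case: (boolP (single w b)) => [sb|_ e]; last by discriminate e.
case Eb: (bridged w B (N.lor W b)) => [q|] e.
  have -> : c = N.lor b (pair_cells q) by case: e.
  exact: white_first_single sb (white_second_bridged (bridged_barrier Eb)).
case E0: (strategy k w B (N.lor W b) h1) e => [[c0 h2]|] e; last by discriminate e.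
have w0 := IH _ _ _ _ _ E0.
have sG d h3 c3 h4 : strategy k w (N.lor B d) (N.lor W b) h3 = Some (c3, h4) ->
  white_first (N.lor W b) c3 by apply: IH.
have := @replies_sound (white_first (N.lor W b)) _ 40 c0 c0 h2 _ _ sG.
case Er: (replies _ _ _ _ _) e => [[c1 h3]|] e; last by discriminate e.
move=> /(_ _ _ erefl)[c01 H].
have -> : c = N.lor b c1 by case: e.
apply: white_first_single sb _.
apply: (white_second_replies w0 _ c01) => y.
(* A reply outside [c0] is refuted by [c0] itself; the others are covered by [replies]. *)
case c0y: (on c0 y); first exact: H.
by exists c0; split; [exact: w0|rewrite c0y|exact: c01].
Qed.

End Window.

Local Arguments N.lor : simpl never.
Local Arguments N.shiftl : simpl never.
Local Arguments N.of_nat : simpl never.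
Local Arguments N.testbit : simpl never.

(** * Rotating the board by 180 degrees *)

Section Rotation.
Variable n : nat.
Implicit Types (P : position n) (x y : cell n) (T : {set cell n}).

Definition rot180 x : cell n := (rev_ord x.1, rev_ord x.2).

Lemma rot180K : involutive rot180.
Proof. by case=> r c; rewrite /rot180 /= !rev_ordK. Qed.

Lemma hex_adj_rot180 x y : hex_adj (rot180 x) (rot180 y) = hex_adj x y.
Proof.
case: x y => [[r1 h1] [c1 k1]] [[r2 h2] [c2 k2]].
rewrite /hex_adj /=; apply/idP/idP; lia.
Qed.

(** The rotation exchanges Black's two edges, so the chain is traversed backwards. *)
Lemma black_connected_rot180 P : black_connected P -> black_connected (P \o rot180).
Proof.
move=> [x [y [Px x0 Py yn /connectP[p pth ey]]]]; subst y.
exists (rot180 (last x p)), (rot180 x); rewrite /= !rot180K.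
have lx := ltn_ord x.2.
split=> //; [by rewrite /= yn; lia|by rewrite /= x0; lia|].
set e := fun a b : cell n => _.
elim: p x {x0 Px Py yn lx} pth => [|z p IH] x /=; first by rewrite connect0.
case/andP=> /andP[/andP[Px Pz] xz] /IH h; apply: connect_trans h _.
apply: connect1; rewrite /e /= !rot180K Px Pz hex_adj_rot180 /=.
by move: xz; rewrite /hex_adj; lia.
Qed.

Lemma place_rot180 P x b : place (P \o rot180) x b = place P (rot180 x) b \o rot180.
Proof.
apply: functional_extensionality => y; rewrite /place /=.
by rewrite (inj_eq (inv_inj rot180K)).
Qed.

Lemma black_wins_rot180 P b : black_wins P b -> black_wins (P \o rot180) b.
Proof.
have [m] := ubnP #|empties P|; elim: m P b => // m IH P b /ltnSE-le /black_wins_turn.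
case=> [[fP cP]|[[z Pz]]].
  by apply: bw_end (black_connected_rot180 cP) => x; apply: fP.
have nf : ~ full (P \o rot180) by move/(_ (rot180 z)); rewrite /= rot180K.
have le' x c : P x = None -> #|empties (place P x c)| < m.
  by move=> Px; apply: leq_trans (card_empties_place c Px) le.
case: b => [[x [Px h]]|h].
  apply: bw_black nf _; exists (rot180 x); rewrite /= rot180K place_rot180 rot180K.
  by split=> //; apply: IH h; apply: le'.
apply: bw_white nf _ => x Px; rewrite place_rot180.
by apply: IH (h _ Px); apply: le'.
Qed.

Lemma virtual_connection_rot180 T :
  virtual_connection T -> virtual_connection (rot180 @^-1: T).
Proof.
move/black_wins_rot180; congr (black_wins _ _).
by apply: functional_extensionality => x; rewrite /stones /= inE.
Qed.

End Rotation.

(** Reversing the order of the [4 * w] bits reverses both rows and columns. *)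
Definition rotate_mask (w : nat) (K : N) : N :=
  foldr (fun i m => if N.testbit K (N.of_nat (4 * w - i.+1)) then N.lor (N.shiftl 1 (N.of_nat i)) m
                    else m) N0 (iota 0 (4 * w)).

Lemma testbit_rotate_mask w K i :
  N.testbit (rotate_mask w K) (N.of_nat i) =
  (i < 4 * w) && N.testbit K (N.of_nat (4 * w - i.+1)).
Proof.
rewrite /rotate_mask -[i < _]/(0 <= i < 0 + 4 * w) -mem_iota.
elim: (iota _ _) => [|j s IH] /=; first exact: N.bits_0.
rewrite inE; case: (boolP (N.testbit K _)) => Kj.
  by rewrite N.lor_spec testbit_bit IH; case: eqP => // ->; rewrite Kj.
by rewrite IH; case: eqP => //= ->; rewrite (negbTE Kj) andbF.
Qed.

Lemma on_rotate_mask n o w K (x : cell n) : o + w <= n ->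
  on o w (rotate_mask w K) x = on (n - w - o) w K (rot180 x).
Proof.
move=> ow; rewrite /on testbit_rotate_mask /inside /cell_index /=.
have := ltn_ord x.1; have := ltn_ord x.2 => l2 l1.
case: (boolP (o <= x.2 < o + w)) => h; last first.
  by have -> : (n - w - o <= n - x.2.+1 < n - w - o + w) = false by move: h; lia.
have -> : n - w - o <= n - x.2.+1 < n - w - o + w by move: h; lia.
have -> : 4 * (x.2 - o) + x.1 < 4 * w by move: h; lia.
rewrite !andTb; congr N.testbit; congr N.of_nat; move: h; lia.
Qed.

(** * Patterns met by every virtual connection *)

Definition refutable (p : nat * N) : Prop :=
  forall n o (T : {set cell n}), o + p.1 <= n -> virtual_connection T ->
  exists2 x, x \in T & on o p.1 p.2 x.

Lemma refutable_rotate w K : refutable (w, K) -> refutable (w, rotate_mask w K).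
Proof.
move=> h n o T ow vT.
have ow' : n - w - o + w <= n by move: ow => /=; lia.
have [x xT Kx] := h n (n - w - o) _ ow' (virtual_connection_rot180 vT).
exists (rot180 x); first by rewrite inE in xT.
by rewrite on_rotate_mask // rot180K.
Qed.

(** The search starts with every window cell outside [K] black; the resulting carrier must lie in
    [K]. *)
Definition checks (w : nat) (K : N) (h : seq N) : bool :=
  if strategy 60 w (N.ldiff (full_mask w) K) N0 h is Some (c, _)
  then (0 < w <= 14) && (N.ldiff c K == N0) else false.

(** If no stone of [T] were on the pattern, no carrier cell would be black and White, moving first,
    would win. *)
Lemma checks_refutable w K h : checks w K h -> refutable (w, K).
Proof.
rewrite /checks; case E: (strategy _ _ _ _ _) => [[c h']|] //.
case/andP=> /andP[w0 w14] cK n o T ow vT.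
case: (pickP [pred x in T | on o w K x]) => [x /andP[xT Kx]|no]; first by exists x.
have wf := strategy_sound w0 w14 ow E.
case: (wf (stones T)) => //; split=> x; first by rewrite on0.
move=> cx; rewrite /stones; case: ifP => // xT.
by have := no x; rewrite /= xT (ldiff_eq0 cK cx).
Qed.

(** * Counting stones *)

Fixpoint mask_of (bs : seq bool) : N :=
  if bs is b :: bs then if b then N.succ_double (mask_of bs) else N.double (mask_of bs)
  else N0.

Lemma testbit_mask_of bs k : N.testbit (mask_of bs) (N.of_nat k) = nth false bs k.
Proof.
elim: bs k => [|b bs IH] [|k] /=; rewrite ?N.bits_0 //.
  by case: b; rewrite ?N.double_spec ?N.succ_double_spec ?N.testbit_even_0 ?N.testbit_odd_0.
rewrite -IH Nnat.Nat2N.inj_succ.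
by case: b; rewrite ?N.double_spec ?N.succ_double_spec ?N.testbit_even_succ' ?N.testbit_odd_succ'.
Qed.

Definition columns : seq (seq bool) :=
  [seq b :: bs | b <- [:: true; false], bs <-
    [seq b :: bs | b <- [:: true; false], bs <-
      [seq [:: b; b'] | b <- [:: true; false], b' <- [:: true; false]]]].

Lemma mem_columns bs : size bs = 4 -> bs \in columns.
Proof. by case: bs => [|[] [|[] [|[] [|[] []]]]]. Qed.

(** A cell in the first column of the pattern guarantees that a matched window does not stick out of
    the board on the left. *)
Definition pattern_ok (p : nat * N) : bool :=
  [&& 0 < p.1 <= 10, has (fun k => N.testbit p.2 (N.of_nat k)) (iota 0 4) & N.ldiff p.2 (full_mask p.1) == N0].

(** Aligns the last column of the pattern with the newest of ten columns. *)
Definition anchored (p : nat * N) : N := N.shiftl p.2 (N.of_nat (4 * (10 - p.1))).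

(** Appending a column either leaves a whole pattern free of stones, which is impossible, or leads
    to a state implied by a listed one: a listed state may assume more black cells and a smaller
    surplus. The second component of a state is [e + 6]; a column changes it by three times its
    stones minus 2. *)
Definition step_ok (ks : seq N) (inv : seq (N * nat)) (s : N * nat) (bs : seq bool) : bool :=
  let t := N.lor s.1 (N.shiftl (mask_of bs) 36) in
  let t' := N.shiftr t 4 in
  let g := s.2 + 3 * count id bs in
  has (fun k => N.land t k == N0) ks
  || has (fun s' => (s'.2 + 2 <= g) && (N.ldiff t' s'.1 == N0)) inv.

Definition invariant_ok (pats : seq (nat * N)) (inv : seq (N * nat)) : bool :=
  [&& all pattern_ok pats, (full_mask 9, 6) \in inv
    & let ks := map anchored pats in all (fun s => all (step_ok ks inv s) columns) inv].

Section Counting.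
Variables (n : nat) (T : {set cell n}).

Definition prefix (j : nat) : {set cell n} := [set x in T | x.2 < j].

Definition column (j : 'I_n) : seq bool := [seq (r, j) \in T | r <- enum 'I_4].

Lemma size_column j : size (column j) = 4.
Proof. by rewrite size_map size_enum_ord. Qed.

Lemma nth_column j (r : 'I_4) : nth false (column j) r = ((r, j) \in T).
Proof. by rewrite (nth_map r) ?size_enum_ord // nth_ord_enum. Qed.

Lemma card_prefixS (j : 'I_n) : #|prefix j.+1| = #|prefix j| + count id (column j).
Proof.
have -> : prefix j.+1 = prefix j :|: [set x in T | x.2 == j].
  by apply/setP => x; rewrite !inE ltnS leq_eqVlt -andb_orr orbC.
rewrite cardsU disjoint_setI0 ?cards0 ?subn0; last first.
  by apply/pred0P => x /=; rewrite !inE; case: eqP => [->|_]; rewrite ?ltnn ?andbF.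
congr (_ + _); rewrite count_map -size_filter -(size_map (fun r : 'I_4 => (r, j))).
rewrite -(card_uniqP _).
  apply: eq_card => x; rewrite !inE; apply/andP/mapP => [[xT /eqP xj]|[r]].
    have ex : x = (x.1, j) by rewrite -xj -surjective_pairing.
    by exists x.1; rewrite // mem_filter mem_enum andbT /= -ex.
  by rewrite mem_filter /= => /andP[rT _] ->.
by rewrite map_inj_uniq => [|a b []] //; apply/filter_uniq/enum_uniq.
Qed.

(* The mask [s.1] describes nine consecutive columns ending just before column
   [j]: its zero bits are genuine empty cells, so columns to the left of the
   board count as solid black. *)
Definition tracked (j : nat) (s : N * nat) : Prop :=
  (forall k, k < 36 -> ~~ N.testbit s.1 (N.of_nat k) ->
     exists x : cell n, [/\ x.2 + 9 = j + k %/ 4, x.1 = k %% 4 :> nat & x \notin T]) /\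
  2 * j + s.2 <= 3 * #|prefix j| + 6.

(** Zero bits of [t] are genuine empty cells, now in ten columns. A pattern disjoint from [t] would
    therefore contain no stone, against [hit], so the other alternative of [step_ok] holds. *)
Lemma tracked_step pats inv (j : 'I_n) s :
  all pattern_ok pats ->
  (forall p, p \in pats -> forall o, o + p.1 <= n -> exists2 x, x \in T & on o p.1 p.2 x) ->
  step_ok (map anchored pats) inv s (column j) -> tracked j s ->
  exists2 s', s' \in inv & tracked j.+1 s'.
Proof.
move=> pok hit ok [emp wt].
set t := N.lor s.1 (N.shiftl (mask_of (column j)) 36).
have empt k : k < 40 -> ~~ N.testbit t (N.of_nat k) ->
    exists x : cell n, [/\ x.2 + 9 = j + k %/ 4, x.1 = k %% 4 :> nat & x \notin T].
  move=> k40; rewrite N.lor_spec (testbit_shiftl _ 36) negb_or testbit_mask_of => /andP[nk].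
  case: (ltnP k 36) => [k36 _|k36]; first exact: emp.
  have r4 : k - 36 < 4 by lia.
  rewrite -[k - 36]/(nat_of_ord (Ordinal r4)) nth_column => nT.
  by exists (Ordinal r4, j); split=> //=; lia.
case/orP: ok => [|/hasP[s' s'inv /andP[wt' sub]]].
  rewrite has_map => /hasP[[w K] pp kill].
  change (is_true (N.land t (N.shiftl K (N.of_nat (4 * (10 - w)))) == N0)) in kill.
  have [/andP[/= w0 w10] nonempty Kfull] := and3P (allP pok _ pp).
  have off k : N.testbit K (N.of_nat k) ->
      exists x : cell n, [/\ x.2 + w = j.+1 + k %/ 4, x.1 = k %% 4 :> nat & x \notin T].
    move=> Kk; have kw : k < 4 * w.
      have := congr1 (fun M => N.testbit M (N.of_nat k)) (eqP Kfull).
      by rewrite N.ldiff_spec testbit_full Kk N.bits_0; case: ltnP.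
    have k40 : k + 4 * (10 - w) < 40 by lia.
    have nk : ~~ N.testbit t (N.of_nat (k + 4 * (10 - w))).
      have := congr1 (fun M => N.testbit M (N.of_nat (k + 4 * (10 - w)))) (eqP kill).
      by rewrite N.land_spec testbit_shiftl leq_addl addnK Kk !andbT N.bits_0 => /negbT.
    by have [x [x2 x1 xT]] := empt _ k40 nk; exists x; split=> //; lia.
  (* A pattern cell in the first column of the window is a genuine cell, in column [j.+1 - w] of the
     board. *)
  have jw : w <= j.+1.
    by move: nonempty => /or4P[|||/orP[|//]] /off[x [x2 _ _]]; lia.
  have [|x xT] := hit _ pp (j.+1 - w); first by rewrite subnK.
  case/andP=> ix /off[y [y2 y1]]; suff -> : y = x by rewrite xT.
  move: ix y2 y1; rewrite /inside /cell_index => ix y2 y1.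
  have := ltn_ord x.1; case: x y {xT} ix y2 y1 => [r c] [r' c'] /= ix y2 y1 r4.
  by congr pair; apply: val_inj => /=; lia.
exists s' => //; split=> [k k36 nk|]; last by rewrite card_prefixS; lia.
have [| |x [x2 x1 xT]] := empt (k + 4); first by lia.
  apply: contra nk => tk; have := congr1 (fun M => N.testbit M (N.of_nat k)) (eqP sub).
  by rewrite N.ldiff_spec (testbit_shiftr _ 4) tk N.bits_0; case: (N.testbit _ _).
by exists x; split=> //; lia.
Qed.

(** The reading starts from solid black columns with [e = 0]. Since the surplus [e + 6] is bounded
    below by a natural number after every column, it is nonnegative at the end. *)
Lemma counting pats inv :
  (forall p, p \in pats -> forall o, o + p.1 <= n -> exists2 x, x \in T & on o p.1 p.2 x) ->
  invariant_ok pats inv -> 2 * n <= 3 * #|T| + 6.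
Proof.
move=> hit /and3P[pok init /allP step].
have H j : j <= n -> exists2 s, s \in inv & tracked j s.
  elim: j => [_|j IH jn].
    exists (full_mask 9, 6) => //; split=> [k k36|]; last by rewrite /=; lia.
    by rewrite testbit_full k36.
  have [s si ts] := IH (ltnW jn).
  have ok : step_ok (map anchored pats) inv s (column (Ordinal jn)).
    by have /allP := step _ si; apply; apply/mem_columns/size_column.
  exact: tracked_step pok hit ok ts.
have [s _ [_ wt]] := H n (leqnn n).
have : #|prefix n| <= #|T| by apply: subset_leq_card; apply/subsetP => x; rewrite inE => /andP[].
lia.
Qed.
End Counting.

(** * The certificate *)

Local Open Scope string_scope.
Local Open Scope nat_scope.

(* Width and cells of a pattern, and White's moves for [strategy]: the letters
   A-Z and a-n stand for the cells 0-39.  Rotating by 180 degrees gives further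
   patterns. *)
Definition certificate : seq (N * N * string) := [::
  (4, 0x13ff, "GFHFIJBIJDFIJBB");
  (4, 0xfeff, "MKJODCBNKLOGKHBDBBGJHBDBB");
  (5, 0x136ff, "GNHBNDBNB");
  (5, 0x137f8, "GFHFIJNIJDFIJNN");
  (5, 0x1faff, "NOGBJHBJDBJQOGJHBDBBMOGJHBDBB");
  (5, 0x1fbf8, "GFHFIJNJOQOMOIJDFIJNJOQOMONJOQJOMJO");
  (5, 0x1fef7, "NKLOHKGBJQGBMGBQKLOHGBMKLOHGB");
  (5, 0xfeeff, "QONGSROPSOGKHBDBBGNHNBDNBB");
  (6, 0x137f7f, "JIDCBLORLKNONNNRKRMDCBLORDGCBEFFGBF");
  (6, 0x13df7f, "JOKRPKRLKRMDCBOKRPRLRDGCBEFFGBFIDCBOKRPRLR");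
  (6, 0x13dfc8, "JGHKOKRPKRLKRMGHKOKRPRLRIGHKOKRPRLR");
  (6, 0x13eeff, "GBROKNUOKNQOKNKBRLBRHRBDBRKONUKONQKON");
  (6, 0x13fe7f, "ONPNQRMJDCBQRLNQRMJDCBMNPJDCBJKDCBLJDCB");
  (6, 0x1fb3f8, "RSGFHFIJJNIJDFIJJNJMHNDNNMSNUTPGJHFDFFMSGJHFDFF");
  (6, 0x1fbf7f, "DFGFIJNRSFIGNCJNJMGNCNNMFNGSSNUTPMFSKJGLMILJMNRNSUSQSMGLNJNGLQMGJMNRNSUSQSRSN
    GLUQUSNQSNCBEFFJRNSUSQSGBN");
  (6, 0x1fccff, "ROPSGBOLKUKQKHBODBOKLUQUOPSOGKHBDBBQOPSOGKHBDBB");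
  (6, 0x37e3ff, "GFHFIJRNPUPQPBIRPJIHNDNNUPJDHNIQPJDHNIDFIJRNPUPQPBB");
  (6, 0xef7f7f, "DFGFIJNNGLFIGJCJJQGLFCGJIMGLFKJGLMILJMNQRWMGLNJNGLQMGJMNQRWQNLRWGRWROWCBEFFJQ
    ROWGBN");
  (6, 0xefebff, "QONSGJHFDFFROPSWGFHFIJBIJDHNIDFIJBB");
  (6, 0xfe7eff, "MKLKNOUVWJDCBNKLOWSVRUXTXVTVGKHBDBBGJHBDBB");
  (6, 0xff32ff, "RWUWGBJDHNMHJBDJBGBJMHNDNNHBJNDBJNMWGJHBDBB");
  (7, 0x1367fc8, "JGHKLKMOVONVOIVMGHKLOVIGHKLOV");
  (7, 0x136fec8, "OVPVMJGLVMJGMNNGJGHKKK");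
  (7, 0x136fef7, "MKONPVVLVNPSVHGBOVKJPVVHPSHPYURHPYUYHPSRUHPSRHVHJVGBGHBJKKJBPBLBBHEHFKCKKFHE
    KAKKAHFKCKKCHEKAKKK");
  (7, 0x13deff8, "NQKLOGQKLOHGFQKLOSOVTVPVGQDOOQPFLFFDFQOQODFDFIJQFDOIOEOGFQOHFIQJOQODFGFHFIJQ
    IQDFIJQSVVTOLGYGUGYOGUOGVPOLGYGUGYOGUOGFGKIGKJKLOOGOJKIKLOOLEKLOOOOGDOIOEOEGKJKLOOGO");
  (7, 0x13efdf8, "NMKLOSOMPVVLVMSGKHFDFFVSSTKYKUKRKLOGFHFKKDFKYKLOGKHFDFFUKLOGKHFDFFYSSKRKLOGK
    HFDFFUSSKRKLOGKHFDFFMKSRTVVPVSTMUVVTKYKUKMKTVTVMKKMLVHVVMKLOTMKLOGKHFDFF");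
  (7, 0x13f73f8, "GFHFIJEJNVRSOTYUYSUSIJDFIJEJNVRSOTYUYSUSJMHENVRSOTYUYSUSDENVRSOTYUYSUSNQHVRS
    OTYUYSUSDVRSOTYUYSUSVRSTHYHUHSTDYDUDSTOYOUOYRSHSDSOURSHSDSO");
  (7, 0x13fb778, "SRTRUVRNFJIGEGGDKIEUVPRUVRNFJIGEGGDKIERQTNFJIGEGGDKIENMFGIGJGKGTGPJEGJGKGTGP
    GDKIKEKGDTITETGDPIPEPTFJIGEGGDKIEPFJIGEGGDKIEPNFJIGEGGDKIE");
  (7, 0x17df6cc, "NGSOVTOVPOVQGSOVTVPVMGSOVTVPV");
  (7, 0x17e36ff, "VTGBNMHMKRJRRDMKRJRRKMHRDRRJMHRDRRRHBNMKRJRRDBNMKRJRRTYWGBMJNHNDNKHBMNDBMNSG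
    BMJNHNDNKHBMNDBMNGBMJHNRDNRNKRHBMNRDBMNRTUWGBMJNHNDNKHBMNDBMNGBMJHNRDNRNKRHBMNRDBMNRSGBMJN
    HNDNKHBMNDBMN");
  (7, 0x1fafec9, "OMNNGJGHKKKVRWYRWURWPMJGVRWYWUWLMJGVRWYWUW");
  (7, 0x1fcccff, "VSTWGBSPOLKYKUKYOKUOKLSBSPDBOKLYUYDBOUDBOYSTWWSOGKHBDBBUSTWWSOGKHBDBB");
  (7, 0xefeb6ff, "USRWGNHJBDJBBVSTWaGBNMHJKRMDJKRMKDHRMJDHRMRHBNJKRMDBNJKRM");
  (7, 0xfefccff, "YWVOaZWXaaWSOGKHBDBBROLPVQPOSVQSPTVQGBOLKDHVQVKQKLOBDBOKLVQVOPSOGKHBDBBQOPSO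
    GKHBDBB");
  (8, 0x136cdfc8, "JGHKSZZTZZKLMOIPKZKLMOOIOMGHKKSOZTZPZIGHKKSOZTZPZ");
  (8, 0x136fb37c, "SZTZRNFJIDEDDPZRNFJIDEDDFDRQTNJNMJTJPJPNJMDRRMRDCGJE");
  (8, 0x137f6f79, "RTSVWVVVZSZUTWZLKFLOKFNUKFQKFQTWZLKF");
  (8, 0x13efccff, "RQOPSWSQTZZPZQWOGKHBDBBZWWXOcOYOVOPSGBOLKcKYKLOBDBOKLcYcOPSOGKHBDBBYOPSOGKH
    BDBBcWWOVOPSOGKHBDBBYWWOVOPSOGKHBDBBWYQOXZZQOTZQOVWXQYZZXOcOYOQOXZXZQOOQPZLZZQOPSXQOPSWSZX
    ZTZQOPSOGKHBDBB");
  (8, 0x13f73f7f, "KLJMNFLJMNJNRZVWSXcYcWYWLMNNRZVWSXcYcWYWJBFECACCDEGAGDFNLFNNDLQMFDLIEDFGFIJ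
    MGIJMNGJMNNRZVWSXcYcWYWCBEFAFJNRZVWSXcYcWYWGMNBLFJNRZVWSXcYcWYWNRZVWSXcYcWYWJLMDCBDGCBEFFG
    BFIDCB");
  (8, 0x13fb35f8, "NGFHFKKDFKWYVXVYZVRZTVYZVRVQUXRRTRQGKHFDFFWVVXVVVZYZTVVVZUWVXZZTZGFHFKKDHRM
    DFK");
  (8, 0x13fb36f7, "NHKGBJQGBMGBWYVXVYZVRZTVYZVRVQUXRRTRQHGBWVVXVVVZYZTVVVZUWVXZZTZHKGBJRGBMGB");
  (8, 0x13fb3778, "WVXVYZVRNFJIGEGGDKIEYZTVYZVRNFJIGEGGDKIEVUXRNFJIGEGGDKIERQNMFGIGJGKGXGTJEGJ
    GKGXGTGDKIKEKGDXIXEXGDTITETXFJIGEGGDKIETFJIGEGGDKIEXNFJIGEGGDKIETNFJIGEGGDKIETRNFJIGEGGDKI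
    E");
  (8, 0x1fafccff, "RQOPSOGKHBDBBSQTZVacaYaZVacVaYVaPZVacaYaZaOLVGBKQHVDVVHBKVDBKVGBVLKcKYKLVBD
    BVKLcYQGKHBDBBQaVcbXOGKHBDBBQaVYbXOGKHBDBBGBZaVOPSOLKcKYKcOPSOKYOPSOKcaVOPSOKYaVOPSOKLBZaV
    OScSYScaVSYaVSLDBZaVOScSYScaVSYaVSZaVOScSYScaVSYaVSBDEDFKCFDEKAKADFKCCDEKA");
  (8, 0x1fccfb7c, "OTZWacaYaNMMFDJIDJEDJMZWXaWTScSYScWXaWSYWXaWSPNFJIDEDDZWXaWcWXaWYWXaWTZWaca
    YaFDNMSJJLIESLJMNDMNDCGJEFDNIMPJJLJIDNMNDCGJE");
  (8, 0x1ff7b37c, "SPRUVZaZbZZRWRUVRNFJIDEDDZcbRXRRWRUVFDRQNMJbJXJbNJXNJMDRRMRDCGJEbRUVRNFJIDE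
    DDXRUVRNFJIDEDDXZZRWRUVRNFJIDEDDVPaYaUaZPacPaYPaPRZWacaYaPRUVZVacaYaZcPaacbRXRRPRcacaPRPRU
    VcRPaUaQaPRUVRNFJIDEDD");
  (8, 0x1ff7bf7a, "SPRUVZaZbZZRWRUVRNFJIGEGGDKIEZcbRXRRWRUVRQNMFGIGJGKGKGKJEGJGKGKGKGDKIKEKGDb
    IKEKGDXIKEKbFJIGEGGDKIEXFJIGEGGDKIEbNFJIGEGGDKIEXNFJIGEGGDKIEbRUVRNFJIGEGGDKIEXRUVRNFJIGEG
    GDKIEXZZRWRUVRNFJIGEGGDKIEVPaYaUaZPacPaYPaPRZWacaYaPRUVZVacaYaZcPaacbRXRRPRcacaPRPRUVcRPaU
    aQaPRUVRNFJIGEGGDKIE");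
  (8, 0x3ecdf6f7, "acPcbdWWZWNOQHGBHKGBJQGBMGBMHGBNMOSWHGBOPQSWSTQWMWWMSWQOSWHGBHKGBJQGBMGBTcN
    OQOHGBHKGBJQGBMGBMOHGB");
  (8, 0x537f4cff, "RTSVWVVVZSZUTWZOGKHBDBBGBOLKUKQKLOBDBOKLUQQTWZOGKHBDBB");
  (8, 0xfefcccff, "caZSedabeeaWSOGKHBDBBVSPTZUTSWZUWTXZUGBSPOLKDHZUZKUKZOKUOKLBSOPZUSPDBOKLZUZ
    ODBUODBZSTWXSOGKHBDBBUSTWWSOGKHBDBB");
  (9, 0x136cdeff8, "NQKLOGQKLOHGFQKLOKOWSdXdTdGQDOOQPFLFFDFQOQODFDFIJQFDOIOEOQOGJHFDFFGFHFIJQI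
    QDFIJQFGKIGKJKLOOWSdXdTdGOJKIKLOOWSdXdTdLEKLOOWSdXdTdOWddXddOPIESPOdOPISESSGDOIOEOEGKJKLOO
    WSdXdTdGO");
  (9, 0x13df7b37c, "SPRUVRNFJIDEDDadbdUPWVRXdUPWVRRPWUWQWadbdWRUVRNFJIDEDDXdWRUVRNFJIDEDDWRUVF
    DRQNMJbJXJbNJXNJMDRRMRDCGJEbRUVRNFJIDEDDXRUVRNFJIDEDDadbdUPWVRXdUPWVRUPWVWRWadbdVPWYUXdVPW
    YUVPWYWUWFDaddPRNJdWbgcPRNJdWXgcRQWWQNMJbJXJbNJXNJNPJMWJPIWEWWWMJbJXJPNJQDIGJCJJRaWdbdXdQD
    EGJJCJRaWdbdXd");
  (9, 0x13f73f7cc, "OPNQRJPNQRMJGPNQRMRVdZaWbgcgacaJPIQRRPGUGQGIGPRPRIGGIHRDRRIGHKPPRJKMGGIGGJ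
    HJNKNQRMRVdZaWbgcgacaJRDJNKNQRMRVdZaWbgcgacaJRNKNHNQRMRVdZaWbgcgacaDNQRMRVdZaWbgcgacaQRRUH
    MVdZaWbgcgacaDMVdZaWbgcgacaVYHdZaWbgcgacaDdZaWbgcgacadZabHgHcHabDgDcDabWgWcWgZaHaDaWcZaHaD
    aWJIHRDRRJGHPMGHKPIGHKP");
  (9, 0x13fbc5cff, "VaZZbZZZdcdXZZZdYaZbddXdSOGKHBDBBGBSTOLKYKUKYOKUOKLBSOTYUSTDBOKLYUYODBUODB
    UaZbddXdSOGKHBDBB");
  (9, 0x1fccfb37c, "FDSRQTNJNMJTJPJPNJdabeaXWgWcWgabeaWcabeaWTRNJdabeagabeacabeadaabePRNJaWXgc
    gabeaPRNJcabeaPRNJQDIGJCJJdabeSRTaaXWgWcWRXagabeaSPTWRcabeaSPTWRQDEGJJCJdabeSRTaaXWgWcWRXa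
    gabeaSPTWRcabeaSPTWR");
  (9, 0x1ff7b36f7, "WTVYZdedfddVaVYZcVNRQHGBMHGBHKGBJQGBMGBdgfVbVVaVYZNQVHGBVURfRbRUVHKGBJRGBM
    GBHKGBJQGBMGBfVYZcVNRQHGBMHGBHKGBJQGBMGBbVYZcVNRQHGBMHGBHKGBJQGBMGBbddVaVYZcVNRQHGBMHGBHKG
    BJQGBMGBZTeceYedTegTecTeTVdaegeceTVYZdZegecedgTeegfVbVVTVgegeTVTVYZgVTeYeUeTVYZZVNRQHGBMHG
    BHKGBJQGBMGB");
  (10, 0x13f733f7ce, "OPNQRJPNQRMJGPNQRMRVZhdeafkgkegeJPIQRRPGUGQGIGPRPRIGGIHRDRRIGHKPPRJKMGGI
    GGJHJNKNQRMRVZhdeafkgkegeJRDJNKNQRMRVZhdeafkgkegeJRNKNHNQRMRVZhdeafkgkegeDNQRMRVZhdeafkgke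
    geQRRUHMVZhdeafkgkegeDMVZhdeafkgkegeVYHMZhdeafkgkegeDMZhdeafkgkegeZcHhdeafkgkegeDhdeafkgke
    gehdefHkHgHefDkDgDefakagakdeHeDeagdeHeDeaJIHRDRRJGHPMGHKPIGHKP");
  (10, 0x1eedefb37c, "VYSTWPWaiehdkjfjhfhTYWRNFJIDEDDSRNFJIDEDDFDRQQNMMMJWJSJWNJSNJMDRRMRDCGJE
    WYXRNFJIDEDDTRNFJIDEDDFDRQNMJXJTJXNJTNJMDRRMRDCGJEDFGFIJEJNYPWaiehdkjfjhfhFIYGJNPWaiehdkjf
    jhfhYCJNPWaiehdkjfjhfhYJMGNCNNCGRQSWaiehdkjfjhfhJGWXRNYPaiehdkjfjhfhabRNYiehdkjfjhfhRbNQie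
    hdkjfjhfhhbNkkbiikjNfNNbNkikbNiNbMiIiiieQNjNfNhkjQfQQhkjQfQQhkjNfNNhkjdNfdNdQNjNfNjeNQhhNh
    dNfeNQhhNhdNihkjYfYYhkjYfYYhkjRQQQNeNdNfRQQQNeNdNRMQNeQNjNfNdQNjNfNjQQQNeNdNfQQQNeNdNeYRQN
    jNfNjRNfRNhkjdRNfdRNdYRQNjNfNjRNfRNjYhhRQQQNeNdNeRNhdRNfYhhRQQQNeNdNeRNhdRNRXNQPaiehdkjfjh
    fhNXMPaiehdkjfjhfhIPaiehdkjfjhfhabMiehdkjfjhfhIiehdkjfjhfhiehkjMfMMhkjIfIIhdkjdfdjeMhIhhdf
    eMhIhhdabNQiehdkjfjhfhhbNkkbiikjNfNNbNkikbNiNbMiIiiieQNjNfNhkjQfQQhkjQfQQhkjNfNNhkjdNfdNdQ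
    NjNfNjeNQhhNhdNfeNQhhNhdNGNYWaiehdkjfjhfhGNYWaiehdkjfjhfhFCWXRNJYPaiehdkjfjhfhabRNJYiehdkj
    fjhfhRbNJQiehdkjfjhfhNbJMiehdkjfjhfhhbJkkbiikjJfJJbJkikbJiJbIiEiiieMJjJfJhkjMfMMhkjMfMMhkj
    JfJJhkjdJfdJdMJjJfJjeJMhhJhdJfeJMhhJhdJihkjQfQQhkjQfQQhkjNMMMJeJdJfNMMMJeJdJNMMMJeMJjJfJdM
    JjJfJjMMMJeJdJfMMMJeJdJeQNMJjJfJjNJfNJhkjdNJfdNJdQNMJjJfJjNJfNJjQhhNMMMJeJdJeNJhdNJfQhhNMM
    MJeJdJeNJhdNJihkjYfYYhkjYfYYhkjRQQNMMMJeJdJeNJdNJfRQQNMMMJeJdJeNJdNJRQQNMMMJeMJjJfJdMJjJfJ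
    jMMMJeJdJfMMMJeJdJeQNMJjJfJjNJfNJdQNMJjJfJjNJfNJjQQNMMMJeJdJeNJdNJfQQNMMMJeJdJeNJdNJeYRQNM
    JjJfJjNJfNJjRNJfRNJhkjdRNJfdRNJdYRQNMJjJfJjNJfNJjRNJfRNJjYhhRQQNMMMJeJdJeNJdNJeRNJhdRNJfYh
    hRQQNMMMJeJdJeNJdNJeRNJhdRNJRXNJQaiehdkjfjhfhNXJMaiehdkjfjhfhJXIaiehdkjfjhfhEaiehdkjfjhfha
    bIiehdkjfjhfhEiehdkjfjhfhiehkjIfIIhkjEfEEhdkjdfdjehIhEhdfehIhEhdabJMiehdkjfjhfhhbJkkbiikjJ
    fJJbJkikbJiJbIiEiiieMJjJfJhkjMfMMhkjMfMMhkjJfJJhkjdJfdJdMJjJfJjeJMhhJhdJfeJMhhJhdJabNJQieh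
    dkjfjhfhNbJMiehdkjfjhfhhbJkkbiikjJfJJbJkikbJiJbIiEiiieMJjJfJhkjMfMMhkjMfMMhkjJfJJhkjdJfdJd
    MJjJfJjeJMhhJhdJfeJMhhJhdJihkjQfQQhkjQfQQhkjNMMMJeJdJfNMMMJeJdJNMMMJeMJjJfJdMJjJfJjMMMJeJd
    JfMMMJeJdJeQNMJjJfJjNJfNJhkjdNJfdNJdQNMJjJfJjNJfNJjQhhNMMMJeJdJeNJhdNJfQhhNMMMJeJdJeNJhdNJ
    YCJNPWaiehdkjfjhfhYCJNPWaiehdkjfjhfhYPWaiehdkjfjhfhWaiehdkjfjhfhFEGJNJMGNCNNCGRQCJNSYTRNFJ
    IDEDDPRNFJIDEDDFDRQTNJNMJTJPJPNJMDRRMRDCGJEDFGFIJFJQRSTWPWaiehdkjfjhfhQFIGJCJJRSTWWaiehdkj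
    fjhfhJGRSMQTNNPNQSTWPWaiehdkjfjhfhQSTWPWaiehdkjfjhfhWQNXNTNNSMSTWPWaiehdkjfjhfhISTWPWaiehd
    kjfjhfhTWWXMPaiehdkjfjhfhIPaiehdkjfjhfhabMiehdkjfjhfhIiehdkjfjhfhiehkjMfMMhkjIfIIhdkjdfdje
    MhIhhdfeMhIhhdWXNQPaiehdkjfjhfhNXMPaiehdkjfjhfhIPaiehdkjfjhfhabMiehdkjfjhfhIiehdkjfjhfhieh
    kjMfMMhkjIfIIhdkjdfdjeMhIhhdfeMhIhhdabNQiehdkjfjhfhhbNkkbiikjNfNNbNkikbNiNbMiIiiieQNjNfNhk
    jQfQQhkjQfQQhkjNfNNhkjdNfdNdQNjNfNjeNQhhNhdNfeNQhhNhdNGQRSTWPWaiehdkjfjhfhGQRSTWPWaiehdkjf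
    jhfhFCRSQTNJNMJTJPJPNJQSTWWaiehdkjfjhfhWQNMJXJTJXNJTNJNSMJTJPJMSTWPWaiehdkjfjhfhMSTWPWaieh
    dkjfjhfhJSISTWPWaiehdkjfjhfhESTWPWaiehdkjfjhfhTWWXIaiehdkjfjhfhEaiehdkjfjhfhabIiehdkjfjhfh
    EiehdkjfjhfhiehkjIfIIhkjEfEEhdkjdfdjehIhEhdfehIhEhdWMJXJTJWXJMaiehdkjfjhfhJXIaiehdkjfjhfhE
    aiehdkjfjhfhabIiehdkjfjhfhEiehdkjfjhfhiehkjIfIIhkjEfEEhdkjdfdjehIhEhdfehIhEhdabJMiehdkjfjh
    fhhbJkkbiikjJfJJbJkikbJiJbIiEiiieMJjJfJhkjMfMMhkjMfMMhkjJfJJhkjdJfdJdMJjJfJjeJMhhJhdJfeJMh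
    hJhdJWXNJQaiehdkjfjhfhNXJMaiehdkjfjhfhJXIaiehdkjfjhfhEaiehdkjfjhfhabIiehdkjfjhfhEiehdkjfjh
    fhiehkjIfIIhkjEfEEhdkjdfdjehIhEhdfehIhEhdabJMiehdkjfjhfhhbJkkbiikjJfJJbJkikbJiJbIiEiiieMJj
    JfJhkjMfMMhkjMfMMhkjJfJJhkjdJfdJdMJjJfJjeJMhhJhdJfeJMhhJhdJabNJQiehdkjfjhfhNbJMiehdkjfjhfh
    hbJkkbiikjJfJJbJkikbJiJbIiEiiieMJjJfJhkjMfMMhkjMfMMhkjJfJJhkjdJfdJdMJjJfJjeJMhhJhdJfeJMhhJ
    hdJihkjQfQQhkjQfQQhkjNMMMJeJdJfNMMMJeJdJNMMMJeMJjJfJdMJjJfJjMMMJeJdJfMMMJeJdJeQNMJjJfJjNJf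
    NJhkjdNJfdNJdQNMJjJfJjNJfNJjQhhNMMMJeJdJeNJhdNJfQhhNMMMJeJdJeNJhdNJCJQRSTWPWaiehdkjfjhfhCJ
    QRSTWPWaiehdkjfjhfhQFEGJJCJRSTWWaiehdkjfjhfh");
  (10, 0x1ff7bb7782, "aXZcdhihjhhZeZcdgZVRJNMKIKKHOMIhkjZfZZeZcdgdZYVURQJKMKNKOKjKfNIKNKOKjKfK
    HOMOIOKHjMjIjKHfMfIfjJNMKIKKHOMIfJNMKIKKHOMIjRJNMKIKKHOMIfRJNMKIKKHOMIjVRJNMKIKKHOMIfVRJNM
    KIKKHOMIjZVRJNMKIKKHOMIfZVRJNMKIKKHOMIjZcdgZVRJNMKIKKHOMIfZcdgZVRJNMKIKKHOMIfhhZeZcdgZVRJN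
    MKIKKHOMIdXigicihXikXigXiXZheikigiXZcdhdikigihkXiikjZfZZXZkikiXZXZcdkZXiciYiXZcdZVRJNMKIKK
    HOMI");
  (10, 0x1ff7bc4eff, "aXZcdhVSTOLGBKHBKDBKLZhLZhTZhTZhihhjhhhZeZZZdhkjZfZZeZZcdjZZZdfZZZdfhhhZ
    eZZZdYSOGKHBDBBidhjdhedeZdjdfdfdhedUSOGKHBDBBihjhZhedhkjZfZZeZdjdfdfhhZedGBSTOLKYKUKYOKUOK
    LBSOTYUSTDBOKLYUYODBUODBdXigicihXikXigXiXZheikigiXZcdhdikigihkXiikjZfZZXZkikiXZXZcdkZXiciY
    iXZcdgVZYSOGKHBDBBUSOGKHBDBBGBSTOLKYKUKYOKUOKLBSOTYUSTDBOKLYUYODBUODB")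
]%num.

(* Last nine columns and e + 6. *)
Definition invariant : seq (N * N) := [::
  (0xfffffffff, 6); (0xc900fffff, 5); (0xc007fffff, 5); (0xa100fffff, 5); (0xa07ffffff, 5);
  (0x933ffffff, 5); (0x90808ffff, 5); (0x90807ffff, 5); (0x904c83fff, 5); (0x90417ffff, 5);
  (0x8932037ff, 5); (0x89021007f, 5); (0x890135fff, 5); (0x8840831ff, 5); (0x884080fff, 5);
  (0x88407ffff, 5); (0x8835fffff, 5); (0x88321007f, 5); (0x880b300ff, 5); (0x880a07fff, 5);
  (0x880937fff, 5); (0x8809086ff, 5); (0x8808fffff, 5); (0x85c21007f, 5); (0x85c2037ff, 5);
  (0x850135fff, 5); (0x8500fffff, 5); (0x84c937fff, 5); (0x84c908fff, 5); (0x84c080fff, 5);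
  (0x84c03ffff, 5); (0x84883ffff, 5); (0x844887dff, 5); (0x8437fffff, 5); (0x841b100ff, 5);
  (0x840a07fff, 5); (0x84085ffff, 5); (0x82817ffff, 5); (0x82808ffff, 5); (0x825ffffff, 5);
  (0x81817ffff, 5); (0x8180fffff, 5); (0x815ffffff, 5); (0x80fffffff, 5); (0x6dfffffff, 5);
  (0x5dfffffff, 5); (0x4ffffffff, 5); (0x31037ffff, 5); (0x23fffffff, 5); (0x12817ffff, 5);
  (0x12808ffff, 5); (0x124ffffff, 5); (0x932037fff, 4); (0x9021007ff, 4); (0x90135ffff, 4);
  (0x900ffffff, 4); (0x880831fff, 4); (0x88080ffff, 4); (0x8807fffff, 4); (0x840831fff, 4);
  (0x84080ffff, 4); (0x8407fffff, 4); (0x8221007ff, 4); (0x821ffffff, 4); (0x818100fff, 4);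
  (0x818007fff, 4); (0x814900fff, 4); (0x81400ffff, 4); (0x8121007ff, 4); (0x811ffffff, 4);
  (0x80b300fff, 4); (0x80a07ffff, 4); (0x80937ffff, 4); (0x809086fff, 4); (0x80887ffff, 4);
  (0x8087fffff, 4); (0x807dfffff, 4); (0x805ffffff, 4); (0x5021007ff, 4); (0x502037fff, 4);
  (0x50134ffff, 4); (0x500ffffff, 4); (0x4c937ffff, 4); (0x4c908ffff, 4); (0x4c080ffff, 4);
  (0x4c03fffff, 4); (0x498037fff, 4); (0x4883dffff, 4); (0x480831fff, 4); (0x44887dfff, 4);
  (0x437ffffff, 4); (0x41a100fff, 4); (0x40a07ffff, 4); (0x4085fffff, 4); (0x30fffffff, 4);
  (0x2813fffff, 4); (0x2808fffff, 4); (0x24fffffff, 4); (0x22fffffff, 4); (0x21fffffff, 4);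
  (0x1821007ff, 4); (0x182037fff, 4); (0x1813fffff, 4); (0x180ffffff, 4); (0x14fffffff, 4);
  (0x1221007ff, 4); (0x121ffffff, 4); (0x11817ffff, 4); (0x114ffffff, 4); (0x1121007ff, 4);
  (0x1117fffff, 4); (0xffffffff, 4); (0x821007fff, 3); (0x82037ffff, 3); (0x811221007, 3);
  (0x81100ffff, 3); (0x8104c83ff, 3); (0x810417fff, 3); (0x810331037, 3); (0x8103300ff, 3);
  (0x81031037f, 3); (0x810207fff, 3); (0x810137fff, 3); (0x810108fff, 3); (0x8100fffff, 3);
  (0x80840833f, 3); (0x8084080ff, 3); (0x808407fff, 3); (0x80821ffff, 3); (0x80811ffff, 3);
  (0x8080fffff, 3); (0x804ca07ff, 3); (0x804c937ff, 3); (0x804c908ff, 3); (0x804c887ff, 3);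
  (0x804887fff, 3); (0x80437ffff, 3); (0x8041a300f, 3); (0x803dfffff, 3); (0x8037fffff, 3);
  (0x800ffffff, 3); (0x421007fff, 3); (0x42037ffff, 3); (0x411221007, 3); (0x41100ffff, 3);
  (0x4104c83ff, 3); (0x410417fff, 3); (0x410331037, 3); (0x4103300ff, 3); (0x41031037f, 3);
  (0x410207fff, 3); (0x410137fff, 3); (0x410108fff, 3); (0x40840833f, 3); (0x4084080ff, 3);
  (0x408407fff, 3); (0x40831ffff, 3); (0x4080fffff, 3); (0x404ca07ff, 3); (0x404c937ff, 3);
  (0x404c908ff, 3); (0x404c887ff, 3); (0x404887fff, 3); (0x4043a300f, 3); (0x40437ffff, 3);
  (0x403ffffff, 3); (0x221007fff, 3); (0x22037ffff, 3); (0x211021007, 3); (0x211007fff, 3);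
  (0x2104c83ff, 3); (0x210403fff, 3); (0x21037ffff, 3); (0x2100fffff, 3); (0x20cc07fff, 3);
  (0x20933ffff, 3); (0x2084883ff, 3); (0x20808ffff, 3); (0x207ffffff, 3); (0x18100ffff, 3);
  (0x18007ffff, 3); (0x14900ffff, 3); (0x1400fffff, 3); (0x121007fff, 3); (0x12037ffff, 3);
  (0x111037fff, 3); (0x1104c83ff, 3); (0x110483fff, 3); (0x11037ffff, 3); (0x1100fffff, 3);
  (0x1090137ff, 3); (0x1086fffff, 3); (0x10817ffff, 3); (0x105ffffff, 3); (0x1037fffff, 3);
  (0x102ffffff, 3); (0xa100ffff, 3); (0xa07fffff, 3); (0x933fffff, 3); (0x90808fff, 3);
  (0x90807fff, 3); (0x904c83ff, 3); (0x90417fff, 3); (0x8840831f, 3); (0x884080ff, 3);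
  (0x88407fff, 3); (0x8835ffff, 3); (0x8808ffff, 3); (0x85c21007, 3); (0x85c2037f, 3);
  (0x850135ff, 3); (0x8500ffff, 3); (0x84c937ff, 3); (0x84c908ff, 3); (0x84c080ff, 3);
  (0x84c03fff, 3); (0x84883fff, 3); (0x844887df, 3); (0x8437ffff, 3); (0x841b100f, 3);
  (0x840a07ff, 3); (0x84085fff, 3); (0x82817fff, 3); (0x82808fff, 3); (0x825fffff, 3);
  (0x81817fff, 3); (0x8180ffff, 3); (0x815fffff, 3); (0x80ffffff, 3); (0x6dffffff, 3);
  (0x5dffffff, 3); (0x4fffffff, 3); (0x31037fff, 3); (0x23ffffff, 3); (0x12817fff, 3);
  (0x12808fff, 3); (0x124fffff, 3); (0x81007ffff, 2); (0x8006fffff, 2); (0x8005fffff, 2);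
  (0x4100fffff, 2); (0x4007dffff, 2); (0x4005fffff, 2); (0x21007ffff, 2); (0x2037fffff, 2);
  (0x11021007f, 2); (0x1102037ff, 2); (0x11007ffff, 2); (0x104c83fff, 2); (0x10403ffff, 2);
  (0x10231007f, 2); (0x102300fff, 2); (0x1022037ff, 2); (0x102104c83, 2); (0x10210437f, 2);
  (0x1021037ff, 2); (0x1020cc07f, 2); (0x1020937ff, 2); (0x1020908ff, 2); (0x102084887, 2);
  (0x10207ffff, 2); (0x10136ffff, 2); (0x10135ffff, 2); (0x10108ffff, 2); (0x101037fff, 2);
  (0x100ffffff, 2); (0x932037ff, 2); (0x9021007f, 2); (0x90135fff, 2); (0x900fffff, 2);
  (0x840831ff, 2); (0x84080fff, 2); (0x8407ffff, 2); (0x8221007f, 2); (0x821fffff, 2);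
  (0x8121007f, 2); (0x811fffff, 2); (0x80b300ff, 2); (0x80a07fff, 2); (0x80937fff, 2);
  (0x809086ff, 2); (0x80887fff, 2); (0x8087ffff, 2); (0x807dffff, 2); (0x805fffff, 2);
  (0x5021007f, 2); (0x502037ff, 2); (0x50134fff, 2); (0x500fffff, 2); (0x4c937fff, 2);
  (0x4c908fff, 2); (0x4c080fff, 2); (0x4c03ffff, 2); (0x4883dfff, 2); (0x44887dff, 2);
  (0x437fffff, 2); (0x41a100ff, 2); (0x40a07fff, 2); (0x4085ffff, 2); (0x30ffffff, 2);
  (0x2813ffff, 2); (0x2808ffff, 2); (0x24ffffff, 2); (0x22ffffff, 2); (0x21ffffff, 2);
  (0x1821007f, 2); (0x182037ff, 2); (0x1813ffff, 2); (0x180fffff, 2); (0x14ffffff, 2);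
  (0x121fffff, 2); (0x11817fff, 2); (0x114fffff, 2); (0x1117ffff, 2); (0xfffffff, 2);
  (0x1021007ff, 1); (0x102037fff, 1); (0x1006fffff, 1); (0x1003fffff, 1); (0x80821fff, 1);
  (0x80811fff, 1); (0x8080ffff, 1); (0x803dffff, 1); (0x8037ffff, 1); (0x40831fff, 1);
  (0x4080ffff, 1); (0x403fffff, 1); (0x221007ff, 1); (0x22037fff, 1); (0x211007ff, 1);
  (0x2104c83f, 1); (0x210403ff, 1); (0x21037fff, 1); (0x2100ffff, 1); (0x20cc07ff, 1);
  (0x20933fff, 1); (0x2084883f, 1); (0x20808fff, 1); (0x207fffff, 1); (0x14900fff, 1);
  (0x1400ffff, 1); (0x121007ff, 1); (0x12037fff, 1); (0x111037ff, 1); (0x1104c83f, 1);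
  (0x110483ff, 1); (0x11037fff, 1); (0x1086ffff, 1); (0x10817fff, 1); (0x105fffff, 1);
  (0x1037ffff, 1); (0x102fffff, 1); (0x8840831, 1); (0x84c937f, 1); (0x84c908f, 1);
  (0x84883ff, 1); (0x844887d, 1); (0x8437fff, 1); (0x841b100, 1); (0x84085ff, 1);
  (0x6dfffff, 1); (0x5dfffff, 1); (0x4ffffff, 1); (0x21007fff, 0); (0x2037ffff, 0);
  (0x11021007, 0); (0x104c83ff, 0); (0x4c937ff, 0); (0x4c908ff, 0); (0x4883dff, 0);
  (0x44887df, 0); (0x437ffff, 0); (0x41a100f, 0); (0x40a07ff, 0); (0x4085fff, 0);
  (0x1821007, 0); (0x182037f, 0); (0x180ffff, 0); (0xffffff, 0)
]%num.

(** Characters before [A], such as blanks and line breaks, are skipped. The offsets 65 and 71 send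
    [A] to 0 and [a] to 26. *)
Fixpoint decode (s : string) : seq N :=
  if s is String a s then
    let v := N_of_ascii a in
    if (v <? 65)%num then decode s
    else N.shiftl 1 (v - (if v <? 97 then 65 else 71))%num :: decode s
  else [::].

Definition patterns : seq (nat * N) :=
  flatten [seq let w := N.to_nat e.1.1 in [:: (w, e.1.2); (w, rotate_mask w e.1.2)]
          | e <- certificate].

Lemma certificate_checks :
  all (fun e => checks (N.to_nat e.1.1) e.1.2 (decode e.2)) certificate.
Proof. by vm_compute. Qed.

Lemma invariant_checks :
  invariant_ok patterns [seq (s.1, N.to_nat s.2) | s <- invariant].
Proof. by vm_compute. Qed.

(** Only the listed patterns are checked by computation; their rotations follow by symmetry of the
    game. *)
Lemma patterns_refutable p : List.In p patterns -> refutable p.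
Proof.
rewrite /patterns; have := certificate_checks.
elim: certificate => //= -[[w K] h] cert IH /andP[/checks_refutable r /IH{}IH].
by case=> [<-//|[<-|//]]; apply: refutable_rotate.
Qed.

Lemma virtual_connection_card n (T : {set cell n}) :
  virtual_connection T -> 2 * n <= 3 * #|T| + 6.
Proof.
move=> vT; apply: counting invariant_checks => p pp o ow.
apply: patterns_refutable ow vT.
by elim: patterns pp => //= q s IH; rewrite inE => /predU1P[->|/IH]; [left|right].
Qed.

Theorem theorem12p3 (n : nat) (hn : (4 <= n)%N) :
  exists S : {set cell n},
    virtual_connection S /\
    (#|S|%:Z = Num.ceil ((2%:R * n%:R / 3%:R - 2%:R) : rat))%R /\
    (forall T : {set cell n}, virtual_connection T -> (#|S| <= #|T|)%N).
Proof.
exists (stone_set n); split; first exact: stone_set_wins.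
have cS := card_stone_set hn; split; last first.
  by move=> T /virtual_connection_card; rewrite cS; lia.
apply/esym/ceil_def; rewrite cS.
(* These are the defining bounds of the ceiling, [k - 1 < 2n/3 - 2 <= k], with denominators cleared
   and the strict one sharpened over the integers. *)
set k := _ %/ 3; have [lo hi] : 2 * n <= 3 * k + 6 /\ 3 * k + 4 <= 2 * n by rewrite /k; lia.
have {}lo : (2 * n%:R <= 3 * k%:R + 6 :> rat)%R.
  by rewrite -!natrM -natrD ler_nat.
have {}hi : (3 * k%:R + 4 <= 2 * n%:R :> rat)%R.
  by rewrite -!natrM -natrD ler_nat.
rewrite intrB; change (k%:Z%:~R)%R with (k%:R : rat)%R.
apply/andP; split; lra.
Qed.
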